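(* Let $\Sigma=(\sigma_n:F_r\to\operatorname{Sym}(V_n))_{n\ge 1}$ be a homomorphic sofic approximation of the free group $F_r$. For the hard-core subshift $X_{\rm hc}$ over $F_r$, set $$q_\Sigma=\limsup_{n\to\infty}\frac{\alpha(\mathcal G_{\sigma_n})}{|V_n|},$$ where $\alpha(\mathcal G_{\sigma_n})$ is the independence number of the action graph of $\sigma_n$. Let $\rho_0$ be the continuous pseudometric on $X_{\rm hc}$ given by $\rho_0(x,y)=|x_e-y_e|$. Then $$\operatorname{mdim}_\Sigma(X_{\rm hc})=\underline{\operatorname{mdim}}_{\Sigma,\mathrm M}(X_{\rm hc},\rho_0)=\overline{\operatorname{mdim}}_{\Sigma,\mathrm M}(X_{\rm hc},\rho_0)=q_\Sigma .$$
   Context: $F_r=\langle s_1,\dots,s_r\rangle$ ($r\ge 1$) is the free group on $S=\{s_1,\dots,s_r\}$, with identity $e$. Hard-core subshift: $X_{\rm hc}=\{x\in[0,1]^{F_r}: x_gx_{gs}=0\text{ for all }g\in F_r,\ s\in S\}$ (product topology), with $F_r$ acting by the left shift $(hx)_g=x_{h^{-1}g}$. Homomorphic sofic approximation: a sequence $\Sigma=(\sigma_n:F_r\to\operatorname{Sym}(V_n))_{n\ge1}$ of group homomorphisms, with $V_n$ finite, $|V_n|\to\infty$, and $|\{v\in V_n:\sigma_n(g)v=v\}|/|V_n|\to0$ for every $g\ne e$. Action graph: for a homomorphism $\sigma:F_r\to\operatorname{Sym}(V)$, $V$ finite, $\mathcal G_\sigma$ is the undirected multigraph with vertex set $V$ and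 edges $\{v,\sigma(s_j)v\}$, $v\in V$, $1\le j\le r$ (loops and multiple edges allowed). A set $I\subseteq V$ is independent if it contains no two endpoints of an edge and no looped vertex; $\alpha(\mathcal G_\sigma)$ is the maximum size of an independent set. Microstates: let $G$ be a countable group acting continuously on a compact metrizable space $X$, and $\rho$ a continuous pseudometric on $X$. For $\varphi,\psi:V\to X$ ($V$ finite) put $\rho_2(\varphi,\psi)=\big(\frac1{|V|}\sum_{v\in V}\rho(\varphi(v),\psi(v))^2\big)^{1/2}$ and $\rho_\infty(\varphi,\psi)=\max_{v\in V}\rho(\varphi(v),\psi(v))$. For finite nonempty $F\subseteq G$, $\delta>0$ and $\sigma:G\to\operatorname{Sym}(V)$, let $\operatorname{Map}(\rho,F,\delta,\sigma)$ be the set of $\varphi:V\to X$ with $\rho_2(\varphi\circ\sigma(s),s\varphi)\le\delta$ for all $s\in F$, where $(s\varphi)(v)=s(\varphi(v))$. Sofic mean dimension: for a finite open cover $\gamma$ of a space $Y$, $\operatorname{ord}(\gamma)=\max_{y\in Y}\sum_{U\in\gamma}1_U(y)-1$, and $D(\gamma)=\min_\beta\operatorname{ord}(\beta)$ over finite open covers $\beta$ of $Y$ refining $\gamma$ (every member of $\beta$ is contained in a member of $\gamma$). For a finite open cover $\mathcal U$ of $X$, $\mathcal U^V$ is the product cover of $X^V$ and $D(\mathcal U,\rho,F,\delta,\sigma)=D(\mathcal U^V|_{\operatorname{Map}(\rho,F,\delta,\sigma)})$. Then $$\operatorname{mdim}_\Sigma(X)=\sup_{\mathcal U}\inf_F\inf_{\delta>0}\limsup_{n\to\infty}\frac{D(\mathcal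 U,\rho,F,\delta,\sigma_n)}{|V_n|},$$ where $\rho$ is a compatible metric on $X$ (the value does not depend on it), $\mathcal U$ ranges over finite open covers of $X$ and $F$ over finite nonempty subsets of $G$. Sofic metric mean dimension: for a pseudometric space $(Y,\rho')$ and $\varepsilon>0$, $N_\varepsilon(Y,\rho')$ is the largest cardinality of a subset $E\subseteq Y$ with $\rho'(x,y)>\varepsilon$ for all distinct $x,y\in E$. Put $$h^\varepsilon_{\Sigma,\infty}(\rho)=\inf_F\inf_{\delta>0}\limsup_{n\to\infty}\frac1{|V_n|}\log N_\varepsilon(\operatorname{Map}(\rho,F,\delta,\sigma_n),\rho_\infty),$$ and let $\underline{\operatorname{mdim}}_{\Sigma,\mathrm M}(X,\rho)$ and $\overline{\operatorname{mdim}}_{\Sigma,\mathrm M}(X,\rho)$ be respectively the $\liminf$ and the $\limsup$, as $\varepsilon\downarrow0$, of $h^\varepsilon_{\Sigma,\infty}(\rho)/|\log\varepsilon|$. *)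

(* Defs.v *)
From HB Require Import structures.
From mathcomp Require Import all_boot all_order all_algebra all_fingroup.
From mathcomp Require Import all_classical all_reals all_analysis.
From mathcomp Require Import lra.

Set Implicit Arguments.
Unset Strict Implicit.
Unset Printing Implicit Defensive.

Import Order.TTheory GRing.Theory Num.Theory.
Import numFieldNormedType.Exports.

Local Open Scope classical_set_scope.
Local Open Scope ring_scope.

(* The free group: reduced words in the letters s_i = (i, false) and          *)
(* s_i^-1 = (i, true).                                                        *)
Section FreeGroup.
Variable r : nat.

Definition letter : Type := ('I_r * bool)%type.

Definition linv (a : letter) : letter := (a.1, ~~ a.2).

Definition reduced (w : seq letter) : bool :=
  sorted (fun a b => b != linv a) w.

Definition push (a : letter) (w : seq letter) : seq letter :=
  if w is b :: w' then if b == linv a then w' else a :: w else [:: a].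

Definition wmul (u v : seq letter) : seq letter := foldr push v u.

Definition winv (u : seq letter) : seq letter := rev (map linv u).

Lemma linvK : involutive linv.
Proof. by case=> i b; rewrite /linv /= negbK. Qed.

Lemma reduced_behead a w : reduced (a :: w) -> reduced w.
Proof. exact: path_sorted. Qed.

Lemma push_reduced a w : reduced w -> reduced (push a w).
Proof.
case: w => [//|b w] rw /=; case: ifPn => [_|ba]; first exact: reduced_behead rw.
by rewrite /reduced /= ba.
Qed.

Lemma push_linv a w : reduced w -> push (linv a) (push a w) = w.
Proof.
case: w => [|b w] /=; first by rewrite linvK eqxx.
case: eqP => [-> | _] rw; last by rewrite /= linvK eqxx.
by case: w rw => [//|c w] /= /andP[/negbTE ->].
Qed.

Lemma push_cons a w : reduced (a :: w) -> push a w = a :: w.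
Proof. by case: w => [//|b w] /= /andP[/negbTE ->]. Qed.

Lemma wmul_reduced u v : reduced v -> reduced (wmul u v).
Proof. by move=> rv; elim: u => //= a u; exact: push_reduced. Qed.

Lemma wmul_push a u v : reduced v ->
  wmul (push a u) v = push a (wmul u v).
Proof.
move=> rv; case: u => [//|b u] /=; case: eqP => [->|//].
by rewrite -{1}(linvK a) push_linv// wmul_reduced.
Qed.

Lemma wmulA u v w : reduced w -> wmul u (wmul v w) = wmul (wmul u v) w.
Proof. by move=> rw; elim: u => //= a u ->; rewrite wmul_push. Qed.

Lemma wmul0 u : reduced u -> wmul u [::] = u.
Proof.
elim: u => //= a u IHu rau.
by rewrite IHu ?push_cons//; exact: reduced_behead rau.
Qed.

Lemma winvK : involutive winv.
Proof. by move=> u; rewrite /winv map_rev revK mapK//; exact: linvK. Qed.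

Lemma winv_reduced u : reduced u -> reduced (winv u).
Proof.
rewrite /reduced /winv rev_sorted sorted_map.
apply: sub_sorted => a b /=; apply: contra => /eqP e.
by rewrite e linvK.
Qed.

Lemma wmulV u : reduced u -> wmul (winv u) u = [::].
Proof.
elim: u => // a u IHu rau; have ru := reduced_behead rau.
rewrite /winv /= rev_cons /wmul foldr_rcons -(push_cons rau) push_linv//.
exact: IHu.
Qed.

Definition free_group : Type := {w : seq letter | reduced w}.

HB.instance Definition _ := Countable.on free_group.

Definition fg_one : free_group := exist _ [::] isT.
Definition fg_mul (g h : free_group) : free_group :=
  exist _ (wmul (val g) (val h)) (wmul_reduced (val g) (valP h)).
Definition fg_inv (g : free_group) : free_group :=
  exist _ (winv (val g)) (winv_reduced (valP g)).

Lemma fg_mulA : associative fg_mul.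
Proof. by move=> g h k; apply: val_inj; rewrite /= wmulA//; exact: valP. Qed.
Lemma fg_mul1 : left_id fg_one fg_mul.
Proof. by move=> g; apply: val_inj. Qed.
Lemma fg_1mul : right_id fg_one fg_mul.
Proof. by move=> g; apply: val_inj; rewrite /= wmul0//; exact: valP. Qed.
Lemma fg_mulV : left_inverse fg_one fg_inv fg_mul.
Proof. by move=> g; apply: val_inj; rewrite /= wmulV//; exact: valP. Qed.
Lemma fg_Vmul : right_inverse fg_one fg_inv fg_mul.
Proof.
move=> g; apply: val_inj; rewrite /= -{1}(winvK (val g)) wmulV//.
exact/winv_reduced/valP.
Qed.

HB.instance Definition _ := isGroup.Build free_group
  fg_mulA fg_mul1 fg_1mul fg_mulV fg_Vmul.

Definition fg_gen (i : 'I_r) : free_group := exist _ [:: (i, false)] isT.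

End FreeGroup.

Section Sofic.
Variables (R : realType) (G : groupType).

(* In {perm V} the product s * t is "s, then t"; homomorphisms to Sym(V) are  *)
(* for the composition of maps, whence the form of hom_mul.                   *)
Record hom_sofic_approx (V : nat -> finType)
    (sigma : forall n, G -> {perm (V n)}) : Prop := HomSoficApprox {
  hom_mul : forall n (g h : G) (v : V n),
    sigma n (g * h)%g v = sigma n g (sigma n h v) ;
  card_to_infty : #|V n| @[n --> \oo] --> \oo ;
  asymp_free : forall g : G, g != 1%g ->
    (#|[pred v : V n | sigma n g v == v]|%:R / #|V n|%:R : R)
      @[n --> \oo] --> (0 : R) }.

Record compatible_metric (X : topologicalType) (rho : X -> X -> R) : Prop :=
  CompatibleMetric {
  metric_eq0 : forall x y, rho x y = 0 <-> x = y ;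
  metric_symm : forall x y, rho x y = rho y x ;
  metric_triang : forall x y z, rho x z <= rho x y + rho y z ;
  metric_nbhs : forall (x : X) (A : set X),
    nbhs x A <-> exists2 e : R, 0 < e & [set y | rho x y < e] `<=` A }.

Section Microstates.
Variables (X : topologicalType) (act : G -> X -> X) (rho : X -> X -> R).
Variable V : finType.

Definition rho_2 (phi psi : V -> X) : R :=
  Num.sqrt (#|V|%:R^-1 * \sum_(v : V) rho (phi v) (psi v) ^+ 2).

Definition rho_oo (phi psi : V -> X) : R :=
  \big[Num.max/0]_(v : V) rho (phi v) (psi v).

Definition Map (F : set G) (delta : R) (sigma : G -> {perm V}) :
    set {ptws V -> X} :=
  [set phi | forall s, F s ->
     rho_2 (fun v => phi (sigma s v)) (fun v => act s (phi v)) <= delta].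

End Microstates.

Section Covers.

Definition finite_open_cover (Y : topologicalType) (gamma : set (set Y)) :=
  [/\ finite_set gamma, gamma `<=` open & \bigcup_(U in gamma) U = setT].

Definition refines (Y : Type) (beta gamma : set (set Y)) :=
  forall B, beta B -> exists2 U, gamma U & B `<=` U.

(* Extended-real valued, equal to -oo for the empty space.                    *)
Definition ord (Y : Type) (gamma : set (set Y)) : \bar R :=
  ereal_sup [set ((\sum_(U \in gamma) (\1_U y : R)) - 1)%:E | y in [set: Y]].

Definition Dcov (Y : topologicalType) (gamma : set (set Y)) : \bar R :=
  ereal_inf [set ord beta | beta in
    [set beta : set (set Y) | finite_open_cover beta /\ refines beta gamma]].

Definition prod_cover (X : Type) (U : set (set X)) (V : Type) :
    set (set {ptws V -> X}) :=
  [set [set phi : {ptws V -> X} | forall v, u v (phi v)] | u in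
    [set u : V -> set X | forall v, U (u v)]].

Definition restrict_cover (T : Type) (Y : set T) (gamma : set (set T)) :
    set (set Y) :=
  [set set_val @^-1` U | U in gamma].

End Covers.

Arguments prod_cover {X} U V _.
Arguments restrict_cover {T} Y gamma _.

Section MeanDimension.
Variables (V : nat -> finType) (sigma : forall n, G -> {perm (V n)}).
Variables (X : topologicalType) (act : G -> X -> X) (rho : X -> X -> R).
Local Open Scope ereal_scope.

Definition finite_nonempty : set (set G) :=
  [set F | finite_set F /\ F !=set0].

Definition inf_F_delta (f : set G -> R -> \bar R) : \bar R :=
  ereal_inf [set ereal_inf [set f F delta | delta in [set d : R | (0 < d)%R]]
            | F in finite_nonempty].

Definition mdim : \bar R :=
  ereal_sup [set inf_F_delta (fun F delta => limn_esup (fun n =>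
      Dcov (restrict_cover (Map act rho F delta (@sigma n))
                           (prod_cover U (V n)))
      * (#|V n|%:R^-1)%:E))
    | U in @finite_open_cover X].

(* N_eps, equal to +oo when there are separated sets of every finite size.    *)
Definition sep_number (Y : Type) (A : set Y) (d : Y -> Y -> R) (eps : R) :
    \bar R :=
  ereal_sup [set (k%:R)%:E | k in [set k : nat | exists E : set Y,
    [/\ E `<=` A, (E #= `I_k)%card &
        forall x y, E x -> E y -> x <> y -> (eps < d x y)%R]]].

Definition h_eps (eps : R) : \bar R :=
  inf_F_delta (fun F delta => limn_esup (fun n =>
    (#|V n|%:R^-1)%:E *
    lne (sep_number (Map act rho F delta (@sigma n))
                    (@rho_oo X rho (V n)) eps))).

Definition lower_mmdim : \bar R :=
  limf_einf (fun eps : R => h_eps eps * (`|ln eps|^-1)%:E) 0^'+.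

Definition upper_mmdim : \bar R :=
  limf_esup (fun eps : R => h_eps eps * (`|ln eps|^-1)%:E) 0^'+.

End MeanDimension.
End Sofic.

Section ActionGraph.
Variables (r : nat) (V : finType) (sigma : free_group r -> {perm V}).

(* The edges of the multigraph are indexed by V * 'I_r; a loop has two equal  *)
(* ends.                                                                      *)
Definition edge_ends (e : V * 'I_r) : V * V := (e.1, sigma (fg_gen e.2) e.1).

Definition independent (I : {set V}) : bool :=
  [forall e, ~~ (((edge_ends e).1 \in I) && ((edge_ends e).2 \in I))].

Definition indep_number : nat := \max_(I : {set V} | independent I) #|I|.

End ActionGraph.

Section HardCore.
Variables (R : realType) (r : nat).

Definition hc_set : set {ptws free_group r -> R} :=
  [set x | (forall g, 0 <= x g <= 1) /\
           (forall g (i : 'I_r), x g * x (g * fg_gen i)%g = 0)].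

(* A subset coerces to a type, which carries the subspace topology.           *)
Definition hardcore : topologicalType := (hc_set : Type).

Definition shift (h : free_group r) (x : {ptws free_group r -> R}) :
  {ptws free_group r -> R} := fun g => x (h^-1 * g)%g.

Lemma shift_hc h x : hc_set x -> hc_set (shift h x).
Proof.
by case=> x01 x0; split=> g; [exact: x01 | move=> i; rewrite /shift mulgA x0].
Qed.

Definition hc_act (h : free_group r) (x : hardcore) : hardcore :=
  exist _ (shift h (set_val x)) (mem_set (shift_hc h (set_valP x))).

Definition rho0 (x y : hardcore) : R := `|set_val x 1%g - set_val y 1%g|.

End HardCore.

Lemma hc_coord_continuous (R : realType) r (g : free_group r) :
  continuous (fun x : hardcore R r => set_val x g : R).
Proof.
move=> x. apply: (@continuous_comp (hardcore R r) {ptws free_group r -> R} R set_val (fun x => x g)).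
  exact: (@initial_continuous _ _ set_val).
exact: (@proj_continuous (free_group r) (fun _ => R) g).
Qed.

Section HardCoreMetric.
Variables (R : realType) (r : nat).

Definition hc_dist (x y : hardcore R r) : R :=
  sup [set `|set_val x g - set_val y g| / 2 ^+ pickle g
      | g in [set: free_group r]].

Implicit Types (x y z : hardcore R r) (g : free_group r).
Local Notation T x y g := (`|set_val x g - set_val y g| / 2 ^+ pickle g).

Lemma hc_bound x g : 0 <= set_val x g <= 1.
Proof. by have [h _] := set_valP x; exact: h. Qed.
Lemma hc_weight_gt0 g : 0 < (2 ^+ pickle g : R).
Proof. by rewrite exprn_gt0. Qed.
Lemma hc_coord_le1 x y g : `|set_val x g - set_val y g| <= 1.
Proof.
have /andP[a b] := hc_bound x g; have /andP[c d] := hc_bound y g.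
rewrite ler_distl; apply/andP; split; rewrite ?lerBlDr; [apply: le_trans d _|apply: le_trans b _]; rewrite ?lerDr ?lerDl// -lerBlDr; lra.
Qed.
Lemma hc_term_ge0 x y g : 0 <= T x y g.
Proof. by rewrite divr_ge0// ltW// hc_weight_gt0. Qed.
Lemma hc_term_le x y g : T x y g <= hc_dist x y.
Proof.
apply: ub_le_sup; last by exists g.
exists 1 => _ [h _ <-]; rewrite ler_pdivrMr ?hc_weight_gt0// mul1r (le_trans (hc_coord_le1 x y h))//.
by rewrite exprn_ege1// ler1n.
Qed.
Lemma hc_dist_le x y (e : R) : (forall g, T x y g <= e) -> hc_dist x y <= e.
Proof.
move=> h; apply: ge_sup; first by exists (T x y (fg_one r)); exists (fg_one r).
by move=> _ [g _ <-].
Qed.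

(* Hence a quantification over all compatible metrics is not vacuous.         *)
Lemma hc_metrizable : exists rho : hardcore R r -> hardcore R r -> R, compatible_metric rho.
Proof.
exists (hc_dist); split.
- move=> x y; split=> [d0|->].
    apply: val_inj; apply/funext => g; apply/eqP; rewrite -subr_eq0 -normr_le0.
    by have := hc_term_le x y g; rewrite d0 ler_pdivrMr ?hc_weight_gt0// mul0r.
  apply/eqP; rewrite eq_le (le_trans (hc_term_ge0 y y (fg_one r)) (hc_term_le y y (fg_one r))) andbT.
  by apply: hc_dist_le => g; rewrite subrr normr0 mul0r.
- by move=> x y; congr sup; apply/seteqP; split=> _ [g _ <-]; exists g => //; rewrite distrC.
- move=> x y z; apply: hc_dist_le => g; apply: le_trans (lerD (hc_term_le x y g) (hc_term_le y z g)).
  by rewrite -mulrDl ler_pM2r ?invr_gt0 ?hc_weight_gt0// ler_distD.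
move=> x A; split=> [|[e e0 eA]]; last first.
  have [N Ne] : exists N : nat, (2 ^- N : R) < e / 2.
    exists (Num.truncn (e / 2)^-1).+1.
    rewrite invf_plt ?posrE ?exprn_gt0 ?divr_gt0//.
    apply: lt_trans (truncnS_gt _) _.
    by rewrite -natrX ltr_nat ltn_expl.
  have H M : \forall y \near x, forall g, (pickle g < M)%N -> `|set_val x g - set_val y g| < e / 2.
    elim: M => [|M IH]; first by apply: (filterS _ (@filterT _ (nbhs x) _)) => y _ g.
    case E : (pickle_inv M : option (free_group r)) => [g|]; last first.
      apply: filterS IH => y IH h; rewrite ltnS leq_eqVlt => /orP[/eqP hM|]; last exact: IH.
      by move: E; rewrite -hM pickleK_inv.
    have gx : \forall y \near x, `|set_val x g - set_val y g| < e / 2.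
      have /cvgrPdist_lt h := @hc_coord_continuous R r g x; apply: h; exact: divr_gt0.
    apply: filterS2 IH gx => y IH hg h; rewrite ltnS leq_eqVlt => /orP[/eqP hM|]; last exact: IH.
    by move: E; rewrite -hM pickleK_inv => -[->].
  apply: filterS (H N) => y hy; apply: eA => /=.
  apply: (@le_lt_trans _ _ (e / 2)); last by rewrite ltr_pdivrMr// mulr_natr mulr2n ltrDl.
  apply: hc_dist_le => g; have [gN|Ng] := ltnP (pickle g) N.
    rewrite ler_pdivrMr ?hc_weight_gt0//; apply: le_trans (ltW (hy g gN)) _.
    by rewrite ler_peMr ?exprn_ege1 ?ler1n ?divr_ge0 ?(ltW e0).
  apply: le_trans (ltW Ne); rewrite ler_pdivrMr ?hc_weight_gt0//; apply: le_trans (hc_coord_le1 x y g) _.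
  by rewrite mulrC ler_pdivlMr ?exprn_gt0// mul1r ler_weXn2l// ler1n.
pose B (e : R) := [set y | hc_dist x y < e].
pose G := filter_from [set e : R | 0 < e] B.
have GF : Filter G.
  apply: filter_from_filter; first by exists 1 => /=.
  move=> i j i0 j0; exists (Num.min i j); first by rewrite /= lt_min i0.
  by move=> z; rewrite /B /= lt_min => /andP.
have Gx : G --> x; last first.
  move=> xA; have [e e0 eA] := Gx _ xA; by exists e.
have cG : (set_val @ G) --> (set_val x : {ptws free_group r -> R}).
  apply/cvg_sup => g U [_ [[W oW <-] Wx] WU].
  have : nbhs (set_val x g : R) W by exact: open_nbhs_nbhs.
  move=> /nbhs_ballP[e /= e0 eW].
  exists (e / 2 ^+ pickle g); first by rewrite /= divr_gt0// hc_weight_gt0.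
  move=> y; rewrite /B /= => dy; apply: WU => /=; apply: eW; rewrite /ball /=.
  have := le_lt_trans (hc_term_le x y g) dy.
  by rewrite ltr_pM2r ?invr_gt0 ?hc_weight_gt0.
move=> U [_ [[W oW <-] Wx] WU].
have : nbhs (set_val x : {ptws free_group r -> R}) W by exact: open_nbhs_nbhs.
by move=> /cG GW; exact: (@filterS _ G GF _ _ WU GW).
Qed.
End HardCoreMetric.

Definition q_Sigma (R : realType) (r : nat) (V : nat -> finType)
    (sigma : forall n, free_group r -> {perm (V n)}) : \bar R :=
  limn_esup (fun n => ((indep_number (@sigma n))%:R / #|V n|%:R : R)%:E).

(* Main.v *)
Require Import Defs.
From HB Require Import structures.
From mathcomp Require Import all_boot all_order all_algebra all_fingroup.
From mathcomp Require Import all_classical all_reals all_analysis.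
From mathcomp Require Import ring lra zify.

Set Implicit Arguments.
Unset Strict Implicit.
Unset Printing Implicit Defensive.

Import Order.TTheory GRing.Theory Num.Theory.
Import numFieldNormedType.Exports.

Local Open Scope classical_set_scope.
Local Open Scope ring_scope.

(* Write y_v for the coordinate at the identity of phi(v), where phi : V -> X is
   a microstate. Along an edge {v, sigma(s) v} the product y_v y_{sigma(s) v} is
   small except on a small proportion of the edges, so all but
   alpha(G_sigma) + o(|V|) of the y_v are small.

   Upper bound for mdim: send phi to the numbers y_v and to the errors
   phi(v)_g - y_{sigma(g^-1) v}, g in a finite set, all soft-thresholded. They
   determine phi up to the fineness of the given cover, and at most
   alpha + o(|V|) of them are non-zero; the union of the coordinate subspaces of
   dimension at most k has fine open covers of order k.
   Lower bound: the cube [0,1]^I, I independent, embeds equivariantly into every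
   set of microstates, and Lebesgue's covering theorem (proved from Kuhn's
   cubical Sperner lemma) applies to it.
   Metric mean dimension: the same two facts, with the cube replaced by a grid
   of mesh 2 eps, and the vector (y_v) rounded to multiples of eps. *)

(** * Kuhn's cubical version of Sperner's lemma *)

Section Prism.

Definition upd (n t : nat) (p : nat -> nat) : nat -> nat :=
  fun i => if i == n then t else p i.

(** The simplices f v_0, ..., f v_i, g v_i, ..., g v_k of the prism between the images of [s] under
    [f] and [g]. *)
Fixpoint prism T (f g : T -> T) (s : seq T) : seq (seq T) :=
  if s is v :: s' then
    (f v :: map g s) :: map (cons (f v)) (prism f g s')
  else [::].

(** The boundary is augmented: the only face of a single vertex is the empty list. *)
Fixpoint bdry T (s : seq T) : seq (seq T) :=
  if s is v :: s' then s' :: map (cons v) (bdry s') else [::].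

(** A chain mod 2 is a list known only through its pairings with test functions [f], so no quotient
    has to be formed. *)
Definition mod2 T (f : T -> bool) (c : seq T) : bool :=
  \big[addb/false]_(x <- c) f x.

Lemma mod2_cons T (f : T -> bool) x c : mod2 f (x :: c) = f x (+) mod2 f c.
Proof. by rewrite /mod2 big_cons. Qed.

Lemma mod2_cat T (f : T -> bool) c d :
  mod2 f (c ++ d) = mod2 f c (+) mod2 f d.
Proof. by rewrite /mod2 big_cat. Qed.

Lemma mod2_map T U (h : T -> U) f c : mod2 f (map h c) = mod2 (f \o h) c.
Proof. by rewrite /mod2 big_map. Qed.

Lemma mod2_flatten T (f : T -> bool) c :
  mod2 f (flatten c) = mod2 (mod2 f) c.
Proof.
elim: c => [|s c IH]; first by rewrite /mod2 !big_nil.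
by rewrite /= mod2_cat mod2_cons IH.
Qed.

Lemma eq_mod2 T (f g : T -> bool) c : f =1 g -> mod2 f c = mod2 g c.
Proof. by move=> fg; apply: eq_bigr => x _. Qed.

Lemma mod2_add T (f g : T -> bool) c :
  mod2 (fun x => f x (+) g x) c = mod2 f c (+) mod2 g c.
Proof. exact: big_split. Qed.

Lemma mod2_exchange T U (f : T -> U -> bool) c d :
  mod2 (fun x => mod2 (f x) d) c = mod2 (fun y => mod2 (f^~ y) c) d.
Proof. exact: exchange_big. Qed.

Lemma bdry_map T U (g : T -> U) s : bdry (map g s) = map (map g) (bdry s).
Proof. by elim: s => //= v s ->; rewrite -!map_comp. Qed.

(* [prism f g] is a chain homotopy between [map f] and [map g]. *)
Lemma bdry_prism T (f g : T -> T) (F : seq T -> bool) (s : seq T) :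
  mod2 (fun u => mod2 F (bdry u)) (prism f g s) =
  F (map f s) (+) F (map g s) (+) mod2 (fun u => mod2 F (prism f g u)) (bdry s).
Proof.
elim: s F => [|v s IH] F; first by rewrite /mod2 !big_nil addbb.
rewrite /= !mod2_cons /= ?mod2_cons !mod2_map.
have -> : mod2 ((fun u => mod2 F (bdry u)) \o cons (f v)) (prism f g s) =
  mod2 F (prism f g s) (+)
  mod2 (fun u => mod2 (F \o cons (f v)) (bdry u)) (prism f g s).
  rewrite -mod2_add; apply: eq_mod2 => u /=.
  by rewrite mod2_cons mod2_map.
rewrite IH /=.
have -> : mod2 ((fun u => mod2 F (prism f g u)) \o cons v) (bdry s) =
  mod2 (fun u => F (f v :: g v :: map g u)) (bdry s) (+)
  mod2 (fun u => mod2 (F \o cons (f v)) (prism f g u)) (bdry s).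
  rewrite -mod2_add; apply: eq_mod2 => u /=.
  by rewrite mod2_cons mod2_map.
have -> : mod2 ((F \o cons (f v)) \o cons (g v)) (bdry (map g s)) =
  mod2 (fun u => F (f v :: g v :: map g u)) (bdry s).
  by rewrite bdry_map mod2_map.
case: (F _); case: (F _) ; case: (F _); case: (mod2 _ _); case: (mod2 _ _); case: (mod2 _ _) => //=.
Qed.

(* The Kuhn triangulation of [0, M]^n, as a chain mod 2 of lists of vertices. *)
Fixpoint kuhn (M n : nat) : seq (seq (nat -> nat)) :=
  if n is n'.+1 then
    flatten [seq flatten [seq prism (upd n' t) (upd n' t.+1) s | s <- kuhn M n']
            | t <- iota 0 M]
  else [:: [:: fun=> 0%N]].

(** By [bdry_prism] the boundary of the layer between heights t and t+1 is its bottom, its top and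
    the prisms over the boundary. Summed over t, the tops and bottoms at intermediate heights
    cancel. *)
Lemma bdry_kuhn M n (F : seq (nat -> nat) -> bool) :
  mod2 (fun u => mod2 F (bdry u)) (kuhn M n.+1) =
  mod2 (F \o map (upd n 0)) (kuhn M n) (+)
  mod2 (F \o map (upd n M)) (kuhn M n) (+)
  mod2 (fun u => mod2 (fun s => mod2 (fun t =>
     mod2 F (prism (upd n t) (upd n t.+1) s)) (iota 0 M)) (bdry u)) (kuhn M n).
Proof.
rewrite [kuhn _ _.+1]/= mod2_flatten mod2_map.
under eq_mod2 => t do rewrite /= mod2_flatten mod2_map.
rewrite mod2_exchange -!mod2_add; apply: eq_mod2 => s /=.
rewrite (mod2_exchange (fun u t => mod2 F (prism (upd n t) (upd n t.+1) u))).
elim: M => [|m IH]; first by rewrite /mod2 !big_nil addbb.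
rewrite -addn1 iotaD !mod2_cat IH {IH} /= add0n addn1.
have mod2_1 (G : nat -> bool) : mod2 G [:: m] = G m.
  by rewrite /mod2 big_cons big_nil addbF.
rewrite !mod2_1 bdry_prism.
by do 3 case: (F _); case: (mod2 _ (iota 0 m)); case: (mod2 _ (bdry s)).
Qed.

Lemma all_prism T (a b : pred T) (f g : T -> T) s :
  (forall x, a x -> b (f x) && b (g x)) -> all a s ->
  all (all b) (prism f g s).
Proof.
move=> ab; elim: s => //= v s IH /andP[/ab/andP[bf bg] sa].
rewrite bf bg all_map (sub_all _ sa) => [|x /ab/andP[]//].
by rewrite all_map (sub_all _ (IH sa))// => u /= ->; rewrite bf.
Qed.

Lemma mod2_eq0 T (a : pred T) (f : T -> bool) c :
  (forall x, a x -> f x = false) -> all a c -> mod2 f c = false.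
Proof.
move=> af; elim: c => [|x c IH] /=; first by rewrite /mod2 big_nil.
by case/andP=> /af fx /IH; rewrite mod2_cons fx => ->.
Qed.

(** The boundary of the cube is carried by its faces, because a prism over a simplex in a face p_i =
    m stays in that face. The condition on the empty list is for n = 0, where it is the boundary of
    the vertex. *)
Lemma bdry_kuhn_eq0 M n (F : seq (nat -> nat) -> bool) : F [::] = false ->
  (forall s i m, (i < n)%N -> m = 0%N \/ m = M ->
     all (fun p : nat -> nat => p i == m) s -> F s = false) ->
  mod2 (fun u => mod2 F (bdry u)) (kuhn M n) = false.
Proof.
elim: n F => [|n IH] F F0 Fz.
  by rewrite /mod2 /= big_seq1 /= big_seq1.
rewrite bdry_kuhn.
have H m : (m = 0 \/ m = M)%N -> mod2 (F \o map (upd n m)) (kuhn M n) = false.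
  move=> hm; rewrite /mod2 big1// => s _ /=; apply: (Fz _ n m) => //.
  by rewrite all_map; elim: s => //= p s ->; rewrite /upd eqxx eqxx.
rewrite !H; [|by right|by left].
apply: IH => [|s i m ni hm H'].
  by rewrite /mod2 big1// => t _; rewrite big_nil.
rewrite /mod2 big1// => t _; rewrite -/(mod2 _ _).
apply: (@mod2_eq0 _ (all (fun p : nat -> nat => p i == m))).
  by move=> u; apply: Fz hm; exact: ltnW.
apply: all_prism H' => p; by rewrite /upd (ltn_eqF ni) => ->.
Qed.

Lemma mod2_bdry_perm (T : eqType) (s I : seq T) :
  mod2 (perm_eq^~ I) (bdry s) = mod2 (fun x => perm_eq s (x :: I)) s.
Proof.
(* The prefix [p] holds the vertices that the recursion has passed. *)
suff H p : mod2 (fun u => perm_eq (p ++ u) I) (bdry s) =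
    mod2 (fun x => perm_eq (p ++ s) (x :: I)) s by exact: (H [::]).
elim: s p => [|v s IH] p; first by rewrite /mod2 !big_nil.
rewrite /= !mod2_cons mod2_map; congr (_ (+) _).
  by rewrite -cat1s perm_catCA perm_cons.
under eq_mod2 => u do rewrite /= -cat_rcons.
by rewrite IH; apply: eq_mod2 => x; rewrite cat_rcons.
Qed.

Lemma mod2_count (T : Type) (a : pred T) s : mod2 a s = odd (count a s).
Proof.
elim: s => [|x s IH]; first by rewrite /mod2 big_nil.
by rewrite mod2_cons IH /= oddD oddb.
Qed.

(** If the labels are 0, ..., n-1 together with x, there is one face labelled 0, ..., n-1 when x =
    n, and two, one for each copy of x, when x < n. *)
Lemma door_count (n : nat) (s : seq nat) : all (leq^~ n) s ->
  mod2 (fun u => perm_eq u (iota 0 n)) (bdry s) = perm_eq s (iota 0 n.+1).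
Proof.
move=> /allP sn; rewrite mod2_bdry_perm.
have E : perm_eq (iota 0 n.+1) (n :: iota 0 n).
  by rewrite -addn1 iotaD cats1 perm_rcons.
rewrite (permPr E).
have [/hasP[x xs Qx]|no] := boolP (has (fun x => perm_eq s (x :: iota 0 n)) s).
  have Qy y : perm_eq s (y :: iota 0 n) = (y == x).
    rewrite (permPl Qx); apply/idP/eqP => [|->]//.
    by rewrite -[x :: _]cat1s -[y :: _]cat1s perm_cat2r => /perm_mem/(_ y); rewrite !inE eqxx => /eqP.
  rewrite Qy mod2_count (eq_count (a2 := pred1 x))//.
  rewrite (seq.permP Qx) /= eqxx add1n /= count_uniq_mem ?iota_uniq// oddb mem_iota.
  have := sn _ xs; rewrite eq_sym leq_eqVlt; lia.
rewrite mod2_count; move: no; rewrite has_count lt0n negbK => /eqP c0; rewrite c0.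
apply/esym/negbTE/negP => Q; move: c0; apply/eqP; rewrite -lt0n -has_count; apply/hasP.
by exists n => //; rewrite (perm_mem Q) inE eqxx.
Qed.

(** Induction on the dimension. By [door_count] the fully labelled simplices have the parity of the
    doors (faces labelled 0, ..., n) in the boundary. A face p_i = 0 with i < n lacks the label i+1
    and a face p_i = M lacks the label 0, so all doors lie in p_n = 0, where the label n+1 is
    excluded and the induction hypothesis counts them. *)
Lemma kuhn_odd M n (l : (nat -> nat) -> nat) : (forall p, l p <= n)%N ->
  (forall p i, (i < n)%N -> p i = 0%N -> l p <> i.+1) ->
  (forall p i, (i < n)%N -> p i = M -> (i < l p)%N) ->
  mod2 (fun s => perm_eq (map l s) (iota 0 n.+1)) (kuhn M n).
Proof.
elim: n l => [|n IH] l ln l0 lM.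
  rewrite /= /mod2 big_cons big_nil /= addbF.
  by have /eqP := ln (fun=> 0%N); rewrite subn0 => ->.
pose F u := perm_eq (map l u) (iota 0 n.+1).
have FN s k : (k <= n)%N -> all (fun p => l p != k) s -> F s = false.
  move=> kn /allP sk; apply/negP => /perm_mem/(_ k).
  rewrite mem_iota add0n ltnS kn /= => /mapP[p ps kp].
  by have := sk p ps; rewrite -kp eqxx.
have bdF s : perm_eq (map l s) (iota 0 n.+2) = mod2 F (bdry s).
  by rewrite -door_count ?bdry_map ?mod2_map// all_map; apply/allP => p _ /=.
rewrite (eq_mod2 _ bdF) bdry_kuhn bdry_kuhn_eq0 ?addbF; first last.
- move=> s i m ni hm sm; rewrite /mod2 big1// => t _; rewrite -/(mod2 _ _).
  apply: (@mod2_eq0 _ (all (fun p : nat -> nat => p i == m))); last first.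
    by apply: all_prism sm => p; rewrite /upd (ltn_eqF ni) => ->.
  move=> u /allP um; case: hm => m0; [apply: (FN u i.+1)|apply: (FN u 0%N)] => //;
      apply/allP => p /um /eqP pm.
    by apply/eqP/l0; rewrite ?pm// ltnW.
  by rewrite -lt0n (leq_ltn_trans _ (lM p i _ _)) ?pm// ltnW.
- by rewrite /mod2 big1// => t _; rewrite big_nil.
rewrite [X in _ (+) X](@mod2_eq0 _ predT) ?all_predT ?addbF// => [|s _].
  under eq_mod2 => s do rewrite /= /F -map_comp.
  apply: IH => [p|p i ni p0|p i ni pM].
  - have := ln (upd n 0 p); rewrite leq_eqVlt => /orP[/eqP E|//].
    by case: (l0 (upd n 0 p) n); rewrite /upd ?eqxx.
  - by apply: l0; rewrite /upd ?(ltn_eqF ni)// ltnW.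
  - by apply: lM; rewrite /upd ?(ltn_eqF ni)// ltnW.
apply: (FN _ 0%N) => //; rewrite all_map; apply/allP => p _ /=.
by rewrite -lt0n (leq_ltn_trans _ (lM _ n _ _)) ?/upd ?eqxx.
Qed.

Lemma mem_prism (T : eqType) (f g : T -> T) s u x :
  u \in prism f g s -> x \in u -> exists2 v, v \in s & x = f v \/ x = g v.
Proof.
elim: s u => // v s IH u /=; rewrite inE => /orP[/eqP->|/mapP[u' /IH{}IH ->]].
  rewrite inE => /orP[/eqP->|]; first by exists v; rewrite ?inE ?eqxx//; left.
  by rewrite -map_cons => /mapP[w ws ->]; exists w; [|right].
rewrite inE => /orP[/eqP->|/IH[w ws]]; first by exists v; rewrite ?inE ?eqxx//; left.
by exists w => //; exact: mem_behead.
Qed.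

Lemma kuhn_close M n s : s \in kuhn M n -> exists q : nat -> nat,
  forall p, p \in s -> forall i, (q i <= p i <= minn M (q i).+1)%N.
Proof.
elim: n s => [|n IH] s /=.
  by rewrite inE => /eqP->; exists (fun=> 0%N) => p; rewrite inE => /eqP->.
case/flattenP => c /mapP[t + ->]; rewrite mem_iota add0n => /andP[_ tM].
case/flattenP => c' /mapP[s' /IH[q qs'] ->] ss'; exists (upd n t q) => p ps i.
have [v vs'] := mem_prism ss' ps.
by rewrite /upd => -[->|->]; case: eqP => ?; rewrite ?qs'//; lia.
Qed.

(** An odd number is positive, so some simplex carries all labels, and it lies in a unit cube. Its
    vertex with label k is [p k]; the value for k > n is arbitrary. *)
Lemma kuhn_sperner M n (l : (nat -> nat) -> nat) : (forall p, l p <= n)%N ->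
  (forall p i, (i < n)%N -> p i = 0%N -> l p <> i.+1) ->
  (forall p i, (i < n)%N -> p i = M -> (i < l p)%N) ->
  exists p : nat -> nat -> nat, [/\ forall k, (k <= n)%N -> l (p k) = k,
    forall k i, (k <= n)%N -> (p k i <= M)%N &
    forall j k i, (j <= n)%N -> (k <= n)%N -> (p j i <= (p k i).+1)%N].
Proof.
move=> ln l0 lM; have := kuhn_odd ln l0 lM.
rewrite mod2_count; move/odd_gt0; rewrite -has_count => /hasP[s /kuhn_close[q qs] ps].
have H k : exists p, (k <= n)%N -> p \in s /\ l p = k.
  have [kn|_] := leqP k n; last by exists id.
  have : k \in map l s by rewrite (perm_mem ps) mem_iota ltnS kn.
  by case/mapP => p ? ?; exists p.
have [p pP] := choice H; exists p; split.
- by move=> k /pP[].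
- by move=> k i /pP[/qs/(_ i)]; lia.
- by move=> j k i /pP[/qs/(_ i) + _] /pP[/qs/(_ i) + _]; lia.
Qed.

End Prism.

(** * Lebesgue's covering theorem *)

Section PointwiseTopology.
Variables (R : realType) (T : choiceType).

Lemma ptws_nbhsP (f : {ptws T -> R}) (W : set {ptws T -> R}) : nbhs f W <->
  exists (K : seq T) (e : R), 0 < e /\
    forall g : {ptws T -> R}, {in K, forall i, `|f i - g i| < e} -> W g.
Proof.
split=> [fW|[K [e [e0 KW]]]]; last first.
  apply: (@filterS _ _ _ [set g : {ptws T -> R} | {in K, forall i, `|f i - g i| < e}]).
    exact: KW.
  elim: K {KW} => [|i K IH]; first by apply: filterS (@filterT _ (nbhs f) _) => g _ i.
  have fi : \forall g \near f, `|f i - g i| < e.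
    have h : (fun g : {ptws T -> R} => g i : R) g @[g --> f] --> (f i : R).
      exact: (@proj_continuous T (fun=> R) i f).
    by move/cvgrPdist_lt : h; exact.
  apply: filterS2 IH fi => g gK gi j; rewrite inE => /predU1P[->//|]; exact: gK.
(* The boxes over finitely many coordinates generate a filter that converges to [f] in every
   coordinate, hence in the product topology; so every neighbourhood contains a box. *)
pose B (p : seq T * R) := [set g : {ptws T -> R} | {in p.1, forall i, `|f i - g i| < p.2}].
pose G := filter_from [set p : seq T * R | 0 < p.2] B.
have GF : Filter G.
  apply: filter_from_filter; first by exists ([::], 1) => /=.
  move=> [K d] [L e] /= d0 e0; exists (K ++ L, Num.min d e); first by rewrite /= lt_min d0.
  move=> g gKL; split=> i iK; have := gKL i; rewrite mem_cat iK ?orbT => /(_ isT);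
    by rewrite lt_min => /andP[].
have Gf : G --> f; last first.
  by have [[K e] /= e0 KW] := Gf _ fW; exists K, e.
apply/cvg_sup => i U [_ [ [X oX <-] Xf] XU].
have : nbhs (f i : R) X by exact: open_nbhs_nbhs.
move=> /nbhs_ballP[e /= e0 eX].
exists ([:: i], e) => //= g gi; apply: XU => /=; apply: eX; rewrite /ball /=.
by apply: gi; rewrite inE.
Qed.

Lemma ptws_itv_compact : compact [set f : {ptws T -> R} | forall i, 0 <= f i <= 1].
Proof.
have := @tychonoff T (fun=> R) (fun=> [set` `[0 : R, 1]]) (fun=> @segment_compact R 0 1).
congr (compact _); apply/seteqP; split=> f /= h i; have := h i;
  by rewrite in_itv.
Qed.

End PointwiseTopology.

(** Compactness gives one [n] for all points; it bounds both the coordinates that matter, in the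
    order of [pickle], and the precision. *)
Lemma ptws_lebesgue_number (R : realType) (T : countType)
    (K : set {ptws T -> R}) (gamma : set (set {ptws T -> R})) :
  compact K -> (forall t, K t -> exists2 W, gamma W & nbhs t W) ->
  exists n : nat, forall t, K t -> exists2 W, gamma W &
    forall t' : {ptws T -> R},
      (forall i, (pickle i < n)%N -> `|t i - t' i| < n.+1%:R^-1) -> W t'.
Proof.
move=> /compact_near_coveringP cK Kgamma.
have [] := cK nat \oo (fun n t => exists2 W, gamma W &
    forall t' : {ptws T -> R},
      (forall i, (pickle i < n)%N -> `|t i - t' i| < n.+1%:R^-1) -> W t') _.
  move=> t /Kgamma[W gW /ptws_nbhsP[L [e [e0 LW]]]].
  (* Halving [e] leaves room to replace [t] by a nearby [t']. *)
  exists ([set t' : {ptws T -> R} | {in L, forall i, `|t i - t' i| < e / 2}],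
    [set n : nat | {in L, forall i, pickle i < n}%N /\ n.+1%:R^-1 < e / 2]).
    split => /=.
      by apply/ptws_nbhsP; exists L, (e / 2); rewrite divr_gt0.
    exists (maxn (\max_(i <- L) (pickle i).+1) (Num.truncn (e / 2)^-1)) => // n /=.
    rewrite geq_max => /andP[Ln en]; split.
      by move=> i iL; apply: leq_trans Ln; rewrite leq_bigmax_seq.
    rewrite invf_plt ?posrE ?divr_gt0//; apply: lt_le_trans (truncnS_gt _) _.
    by rewrite ler_nat.
  move=> [t' n] /= [tt' [Ln ne]]; exists W => // t'' t't''; apply: LW => i iL.
  apply: le_lt_trans (ler_distD (t' i) _ _) _; rewrite [e]splitr ltrD ?tt'//.
  by apply: lt_trans (t't'' i _) ne; exact: Ln.
by move=> n _ /(_ n (leqnn n)) h; exists n => t /h.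
Qed.

Lemma bigmax_ordP n (P : pred 'I_n) k : \max_(i < n | P i) i.+1 = k.+1 ->
  exists2 i : 'I_n, P i & i = k :> nat.
Proof.
have : \max_(i < n | P i) i.+1 = 0%N \/
    exists2 i : 'I_n, P i & \max_(i < n | P i) i.+1 = i.+1.
  elim/big_ind : _ => [|x y [->|[i Pi ->]] [->|[j Pj ->]]|i Pi]; rewrite ?max0n ?maxn0.
  - by left.
  - by left.
  - by right; exists j.
  - by right; exists i.
  - by right; case: (leqP i j) => ij; [exists j|exists i] => //; lia.
  - by right; exists i.
by case=> [->//|[i Pi ->] [<-]]; exists i.
Qed.

(* A member of the cover gets the largest i such that it misses the face
   t_i = 0, counting from 1, and 0 if it meets all these faces; a point of a
   fine grid gets the label of a member containing its neighbours. *)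
Lemma lebesgue_covering (R : realType) n (gamma : set (set {ptws 'I_n -> R})) :
  let cube := [set t : {ptws 'I_n -> R} | forall i, 0 <= t i <= 1] in
  (forall t, cube t -> exists2 W, gamma W & nbhs t W) ->
  (forall W, gamma W -> forall i, (forall t, cube t -> t i = 0 -> ~ W t) \/
     (forall t, cube t -> t i = 1 -> ~ W t)) ->
  exists2 t, cube t & exists B : nat -> set {ptws 'I_n -> R},
    (forall j k, (j <= n)%N -> (k <= n)%N -> B j = B k -> j = k) /\
    forall k, (k <= n)%N -> gamma (B k) /\ B k t.
Proof.
move=> cube gcov gface.
have [m mP] := ptws_lebesgue_number (@ptws_itv_compact R 'I_n) gcov.
(* A grid step has to be strictly smaller than 1/(m+1). The [minn] below keeps every [p] in the
   cube, since labels are needed for all [p]. *)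
pose M := m.+2; have M0 : 0 < M%:R :> R by rewrite ltr0n.
pose pt (p : nat -> nat) : {ptws 'I_n -> R} := fun i => (minn (p i) M)%:R / M%:R.
have ptc p : cube (pt p).
  move=> i; rewrite divr_ge0//= ler_pdivrMr// mul1r ler_nat geq_minr//.
have H p : exists W, gamma W /\
    forall t : {ptws 'I_n -> R}, (forall i, `|pt p i - t i| <= M%:R^-1) -> W t.
  have [W gW WP] := mP _ (ptc p); exists W; split=> // t tP; apply: WP => i _.
  apply: le_lt_trans (tP i) _; rewrite ltf_pV2 ?posrE// ltr_nat//.
have [B BP] := choice H.
have Bpt p : B p (pt p).
  by apply: (BP p).2 => i; rewrite subrr normr0 invr_ge0.
pose lab (W : set {ptws 'I_n -> R}) :=
  \max_(i < n | `[< forall t, cube t -> t i = 0 -> ~ W t >]) i.+1.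
have [|||p [p1 p2 p3]] := @kuhn_sperner M n (fun p => lab (B p)).
- by move=> p; apply/bigmax_leqP.
- move=> p i ni pi0 /bigmax_ordP[j /asboolP h ji]; apply: h (ptc p) _ (Bpt p).
  by rewrite /pt ji pi0 min0n mul0r.
(* The member [B p] meets the face t_i = 1, hence misses the face t_i = 0, and its label is at least
   i+1. *)
- move=> p i ni piM; have [h|h] := gface _ (BP p).1 (Ordinal ni).
    by apply: (@leq_bigmax_cond _ _ (fun i : 'I_n => i.+1) (Ordinal ni)); apply/asboolP.
  by case: (h _ (ptc p) _ (Bpt p)); rewrite /pt /= piM minnn divff// gt_eqF.
(* The vertices found are at most one grid step apart, so all their members contain the first
   vertex; different labels make the members different. *)
exists (pt (p 0%N)) => //; exists (fun k => B (p k)); split.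
  by move=> j k /p1 {2}<- /p1 {2}<- ->.
move=> k kn; split; first exact: (BP _).1.
apply: (BP (p k)).2 => i; rewrite /pt -mulrBl normrM normfV (gtr0_norm M0).
rewrite ler_piMl ?invr_ge0 ?(ltW M0)//.
have := p3 k 0%N i kn isT; have := p3 0%N k i isT kn.
rewrite (minn_idPl (p2 k i kn)) (minn_idPl (p2 0%N i isT)).
rewrite -!(ler_nat R) -!natr1 => h1 h2.
by rewrite ler_norml; apply/andP; split; lra.
Qed.

(** * Order of a finite cover *)

Section Order.
Variables (R : realType) (Y : Type).
Implicit Types (beta : set (set Y)) (y : Y).

Lemma sum_indicE beta y : finite_set beta ->
  \sum_(U \in beta) (\1_U y : R) =
  (count (fun U : set Y => y \in U) (finmap.enum_fset (fset_set beta)))%:R.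
Proof.
move=> fb; rewrite fsbig_finite//= -sum1_count natr_sum [RHS]big_mkcond /=.
by apply: eq_bigr => U _; rewrite indicE; case: (y \in U).
Qed.

Lemma ord_ge beta y n (B : nat -> set Y) : finite_set beta ->
  (forall j k, (j <= n)%N -> (k <= n)%N -> B j = B k -> j = k) ->
  (forall k, (k <= n)%N -> beta (B k) /\ B k y) ->
  (n%:R%:E <= ord R beta)%E.
Proof.
move=> fb Binj Bb; apply: le_ereal_sup_tmp; eexists; first by exists y.
rewrite sum_indicE// lee_fin lerBrDr natr1 ler_nat -size_filter.
rewrite -[n.+1](size_iota 0) -(size_map B); apply: uniq_leq_size.
  rewrite map_inj_in_uniq ?iota_uniq// => j k; rewrite !mem_iota => jn kn.
  exact: Binj.
move=> _ /mapP[k + ->]; rewrite mem_iota ltnS => /Bb[bB By].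
by rewrite mem_filter; apply/andP; split; [exact/mem_set|rewrite in_fset_set// mem_set].
Qed.

(** The members through [y] are mapped injectively into {0, ..., n} by [rk y]. *)
Lemma ord_le beta (rk : Y -> set Y -> nat) n : finite_set beta ->
  (forall y U, beta U -> U y -> (rk y U <= n)%N) ->
  (forall y U U', beta U -> beta U' -> U y -> U' y -> rk y U = rk y U' -> U = U') ->
  (ord R beta <= n%:R%:E)%E.
Proof.
move=> fb rkn rkinj; apply: ge_ereal_sup => _ [y _ <-].
rewrite sum_indicE// lee_fin lerBlDr natr1 ler_nat -size_filter.
rewrite -[n.+1](size_iota 0) -(size_map (rk y)); apply: uniq_leq_size.
  rewrite map_inj_in_uniq ?filter_uniq ?finmap.fset_uniq// => U U'; rewrite !mem_filter.
  rewrite !in_fset_set// => /andP[/set_mem Uy /set_mem bU] /andP[/set_mem U'y /set_mem bU'].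
  exact: rkinj.
move=> _ /mapP[U + ->]; rewrite mem_filter in_fset_set// => /andP[/set_mem Uy /set_mem bU].
by rewrite mem_iota ltnS rkn.
Qed.

End Order.

(** * Compactness of the hard-core subshift; maps into products and subspaces *)

Section HardCoreTopology.
Variables (R : realType) (r : nat).
Notation X := (hardcore R r).

Lemma hc_set_compact : compact (@hc_set R r).
Proof.
have sub : @hc_set R r `<=` [set f : {ptws free_group r -> R} | forall i, 0 <= f i <= 1].
  by move=> x [].
apply: (subclosed_compact _ (@ptws_itv_compact R (free_group r)) sub).
have proj g : continuous (fun x : {ptws free_group r -> R} => x g : R).
  exact: (@proj_continuous (free_group r) (fun=> R) g).
have -> : @hc_set R r = \bigcap_g [set x | 0 <= x g <= 1] `&`
    \bigcap_p [set x | x p.1 * x (p.1 * fg_gen p.2)%g = 0].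
  apply/seteqP; split=> x /=.
    by move=> [x1 x2]; split=> [g _|[g i] _]; [exact: x1|exact: x2].
  by move=> [x1 x2]; split=> [g|g i]; [exact: x1|exact: (x2 (g, i))].
apply: closedI; [apply: closed_bigI => g _|apply: closed_bigI => -[g i] _].
  rewrite (_ : [set x | _] = (fun x : {ptws free_group r -> R} => x g : R) @^-1` [set` `[0 : R, 1]]); last first.
    by apply/seteqP; split=> x /=; rewrite in_itv.
  apply: (@preimage_closed _ R (fun x : {ptws free_group r -> R} => x g : R) [set` `[0 : R, 1]]).
    by move=> x _; exact: proj.
  exact: interval_closed.
apply: (@preimage_closed _ R (fun x : {ptws free_group r -> R} => x g * x (g * fg_gen i)%g : R) [set 0]).
  by move=> x _; apply: continuousM; exact: proj.
exact: closed_eq.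
Qed.

End HardCoreTopology.

Lemma ptws_continuous (S X : topologicalType) (T : choiceType)
    (c : S -> {ptws T -> X}) :
  (forall i, continuous (fun s => c s i)) -> continuous c.
Proof.
move=> cc s; apply/cvg_sup => i U [_ [ [A oA <-] As] AU].
have cA : nbhs (c s i) A by exact: open_nbhs_nbhs.
apply: (@filterS _ (nbhs s) _ ((fun s => c s i) @^-1` A)) => [s' /AU//|].
exact: (cc i s _ cA).
Qed.

Lemma subtype_continuous (S X : topologicalType) (A : set X) (c : S -> A) :
  continuous (fun s => set_val (c s)) -> continuous c.
Proof. by move=> cc; exact: (@continuous_comp_initial A S X set_val). Qed.

(** * The lower bound for the mean dimension *)

Section ExactMicrostates.
Variables (R : realType) (r : nat) (V : finType).
Variable sigma : free_group r -> {perm V}.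
Hypothesis sigmaM : forall g h v, sigma (g * h)%g v = sigma g (sigma h v).
Variables (n : nat) (e : 'I_n -> V).
Hypothesis e_inj : injective e.
Hypothesis e_indep : forall i j k, sigma (fg_gen k) (e i) <> e j.

Lemma sigma1 v : sigma 1%g v = v.
Proof. by apply: (@perm_inj _ (sigma 1%g)); rewrite -sigmaM mulg1. Qed.

Lemma sigmaK g : cancel (sigma g^-1%g) (sigma g).
Proof. by move=> v; rewrite -sigmaM mulgV sigma1. Qed.

(** Clamping extends the embedding of the cube to all of R^n, where [lebesgue_covering] takes its
    neighbourhoods. *)
Definition clamp (x : R) : R := Num.max 0 (Num.min 1 x).

Definition config (t : {ptws 'I_n -> R}) (v : V) : R :=
  if [pick i | e i == v] is Some i then clamp (t i) else 0.

Lemma clamp01 x : 0 <= clamp x <= 1.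
Proof. by rewrite /clamp le_max lexx ge_max ler01 ge_min lexx. Qed.

Lemma clamp_id x : 0 <= x <= 1 -> clamp x = x.
Proof. by case/andP=> x0 x1; rewrite /clamp (min_idPr x1) (max_idPr x0). Qed.

Lemma config_e t i : config t (e i) = clamp (t i).
Proof.
by rewrite /config; case: pickP => [j /eqP/e_inj->//|/(_ i)]; rewrite eqxx.
Qed.

Lemma config_hc t k v : config t (sigma (fg_gen k) v) * config t v = 0.
Proof.
rewrite /config; case: pickP => [j /eqP je|_]; last by rewrite mul0r.
case: pickP => [i /eqP ie|_]; last by rewrite mulr0.
by case: (@e_indep i j k); rewrite ie je.
Qed.

(** The inverse turns the action by [sigma] into the left shift, so that the microstate is exactly
    equivariant. *)
Definition mstate_fun t v : {ptws free_group r -> R} :=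
  fun g => config t (sigma g^-1%g v).

Lemma mstate_hc t v : hc_set (mstate_fun t v).
Proof.
split=> [g|g i]; first by rewrite /mstate_fun /config; case: pickP => *;
  rewrite ?clamp01// lexx ler01.
(* The coordinates g and g s_i are the values at w and sigma(s_i^-1) w, the two ends of an edge. *)
rewrite /mstate_fun invgM sigmaM; set w := sigma g^-1%g v.
by rewrite -{1}[w](sigmaK (fg_gen i)) config_hc.
Qed.

Definition mstate t : {ptws V -> hardcore R r} :=
  fun v => exist _ (mstate_fun t v) (mem_set (mstate_hc t v)).

Lemma mstate_equiv t s v : mstate t (sigma s v) = hc_act s (mstate t v).
Proof.
apply: val_inj; apply/funext => g.
change (config t (sigma g^-1%g (sigma s v)) =
  config t (sigma (s^-1 * g)^-1%g v)).
by rewrite invgM invgK sigmaM.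
Qed.

(** By equivariance only distances rho(x, x) occur, so both compatible metrics and [rho0] are
    covered. *)
Lemma mstate_Map (rho : hardcore R r -> hardcore R r -> R) F delta t :
  (forall x, rho x x = 0) -> 0 < delta ->
  Map (@hc_act R r) rho F delta sigma (mstate t).
Proof.
move=> rho0 d0 s Fs; rewrite /rho_2 big1 ?mulr0 ?sqrtr0 ?ltW// => v _.
by rewrite mstate_equiv rho0 expr0n.
Qed.

Lemma mstate_e t i : set_val (mstate t (e i)) 1%g = clamp (t i).
Proof.
change (config t (sigma 1^-1%g (e i)) = clamp (t i)).
by rewrite invg1 sigma1 config_e.
Qed.

Lemma config_continuous v : continuous (fun t => config t v).
Proof.
rewrite /config; case: [pick i | e i == v] => [i|] t.
  have ti : {for t, continuous (fun t : {ptws 'I_n -> R} => t i : R^o)}.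
    exact: (@proj_continuous 'I_n (fun=> R) i t).
  have c0 (a : R) : {for t, continuous (fun _ : {ptws 'I_n -> R} => a : R^o)}.
    exact: cst_continuous.
  have tm := continuous_min (c0 1) ti.
  exact: (continuous_max (c0 0) tm).
exact: (@cst_continuous {ptws 'I_n -> R} R 0).
Qed.

Lemma mstate_continuous : continuous mstate.
Proof.
apply: ptws_continuous => v.
apply: (@subtype_continuous _ {ptws free_group r -> R}).
apply: ptws_continuous => g.
have h := @config_continuous (sigma g^-1%g v); exact: h.
Qed.

End ExactMicrostates.

Section MeanDimLower.
Variables (R : realType) (r : nat) (V : finType).
Variable sigma : free_group r -> {perm V}.
Hypothesis sigmaM : forall g h v, sigma (g * h)%g v = sigma g (sigma h v).

(** On the embedded cube, [low_set] at the i-th vertex misses the face t_i = 1 and [high_set] misses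
    t_i = 0. *)
Definition low_set : set (hardcore R r) := [set x | set_val x 1%g < 2/3].
Definition high_set : set (hardcore R r) := [set x | 1/3 < set_val x 1%g].
Definition low_high := [set low_set; high_set].

Lemma low_high_cover : finite_open_cover low_high.
Proof.
pose f (x : hardcore R r) : R := set_val x 1%g.
have c x (_ : x \in f @^-1` [set y : R | y < 2/3]) : {for x, continuous f}.
  exact: hc_coord_continuous.
have c' x (_ : x \in f @^-1` [set y : R | 1/3 < y]) : {for x, continuous f}.
  exact: hc_coord_continuous.
split; first by rewrite finite_setU; split; exact: finite_set1.
  move=> _ [->|->].
    exact: (open_comp c (@open_lt R _)).
  exact: (open_comp c' (@open_gt R _)).
apply/seteqP; split => // x _.
have [h|h] := ltP (set_val x 1%g) (2/3); first by exists low_set => //; left.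
by exists high_set; [right|rewrite /high_set /=; lra].
Qed.

(** A refinement [beta] is pulled back to R^n along the embedding of the cube. Each member lies in a
    product of low and high sets, so it misses one face of every opposite pair, and Lebesgue's
    theorem gives n+1 members through one point. *)
Lemma Dcov_ge (rho : hardcore R r -> hardcore R r -> R) F delta n (e : 'I_n -> V) :
  (forall x, rho x x = 0) -> 0 < delta -> injective e ->
  (forall i j k, sigma (fg_gen k) (e i) <> e j) ->
  (n%:R%:E <= Dcov R (@restrict_cover _ (Map (@hc_act R r) rho F delta sigma)
                                     (@prod_cover _ low_high V)))%E.
Proof.
move=> rho0 d0 einj eind; apply: le_ereal_inf_tmp => _ [beta [[fb ob cb] rb] <-].
pose c (t : {ptws 'I_n -> R}) : Map (@hc_act R r) rho F delta sigma :=
  exist _ (mstate sigmaM eind t) (mem_set (@mstate_Map R r V sigma sigmaM n e eind rho F delta t rho0 d0)).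
have cc : continuous c by apply: subtype_continuous; exact: mstate_continuous.
have [||t tc [B [Binj Bg]]] := @lebesgue_covering R n [set c @^-1` U | U in beta].
- move=> t _; have : [set: Map (@hc_act R r) rho F delta sigma] (c t) by [].
  rewrite -cb => -[U bU Ut]; exists (c @^-1` U); first by exists U.
  by apply: cc; apply: open_nbhs_nbhs; split=> //; exact: ob.
- move=> _ [U /[dup] bU /rb[_ [_ [u uU <-] <-] UU] <-] i.
  have [] := uU (e i) => ui; [right|left] => t tc ti /UU /(_ (e i)).
    by rewrite ui /low_set /= mstate_e// clamp_id ?ti//; lra.
  by rewrite ui /high_set /= mstate_e// clamp_id ?ti//; lra.
have H k : exists U, (k <= n)%N -> [/\ beta U, U (c t) & B k = c @^-1` U].
  have [kn|] := leqP k n; last by exists set0.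
  by have [[U bU <-] Ut] := Bg k kn; exists U.
have [U UP] := choice H; apply: (@ord_ge R _ beta (c t) n U fb).
  by move=> j k jn kn UU; apply: Binj => //; have [_ _ ->] := UP j jn;
    have [_ _ ->] := UP k kn; rewrite UU.
by move=> k /UP[].
Qed.

End MeanDimLower.

(** * The upper bound for the mean dimension *)

Section BrickCover.
Variables (R : realType) (Y : topologicalType) (N : finType).
Variables (x : N -> Y -> R) (B : nat).
Hypothesis x_cont : forall i, continuous (x i : Y -> R).
Hypothesis x_ge0 : forall i y, 0 <= x i y.
Hypothesis x_lt : forall i y, x i y < B%:R.

Definition brick_low (m : {ffun N -> 'I_B}) (o : option N) (y : Y) : R :=
  if o is Some j then `|x j y - (m j)%:R| else 0.

Definition brick_high (m : {ffun N -> 'I_B}) (o : option N) (y : Y) : R :=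
  if o is Some i then Num.min (x i y - (m i)%:R) ((m i)%:R + 1 - x i y)
  else 1/2.

(* A neighbourhood of the face of the cubical decomposition of R^N into unit
   cubes on which the coordinates in [S] vary and the others are equal to [m]:
   the free coordinates are farther from the integers than the others. The
   indices [None] add that the latter distances are < 1/2 and the former > 0. *)
Definition brick (c : {set N} * {ffun N -> 'I_B}) : set Y :=
  [set y | forall o o' : option N, oapp (fun j => j \notin c.1) true o ->
     oapp (mem c.1) true o' -> brick_low c.2 o y < brick_high c.2 o' y].

Lemma brick_in c y i : brick c y -> i \in c.1 ->
  (c.2 i)%:R < x i y < (c.2 i)%:R + 1.
Proof.
move=> /(_ None (Some i) isT) /= h /h; rewrite lt_min => /andP[h1 h2].
by rewrite -subr_gt0 h1 -subr_gt0.
Qed.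

Lemma brick_notin c y j : brick c y -> j \notin c.1 ->
  `|x j y - (c.2 j)%:R| < 1/2.
Proof. by move=> /(_ (Some j) None) /= h /h; exact. Qed.

Lemma brick_diam c y y' i : brick c y -> brick c y' -> `|x i y - x i y'| < 1.
Proof.
move=> cy cy'; have [iS|iS] := boolP (i \in c.1).
  by have := brick_in cy iS; have := brick_in cy' iS; rewrite ltr_norml; lra.
have := brick_notin cy iS; have := brick_notin cy' iS.
by rewrite !ltr_norml; lra.
Qed.

Lemma brick_open c : open (brick c).
Proof.
have lc o : continuous (brick_low c.2 o : Y -> R).
  case: o => [j|] y /=; last exact: cvg_cst.
  apply: (@continuous_comp _ _ _ (fun y => x j y - (c.2 j)%:R) Num.norm).
    by apply: continuousB; [exact: x_cont|exact: cvg_cst].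
  exact: norm_continuous.
have hc o : continuous (brick_high c.2 o : Y -> R).
  case: o => [i|] y /=; last exact: cvg_cst.
  have c1 : {for y, continuous (fun y => x i y - (c.2 i)%:R : R^o)}.
    by apply: continuousB; [exact: x_cont|exact: cvg_cst].
  have c2 : {for y, continuous (fun y => (c.2 i)%:R + 1 - x i y : R^o)}.
    by apply: continuousB; [exact: cvg_cst|exact: x_cont].
  exact: (continuous_min c1 c2).
rewrite openE => y cy; rewrite /interior.
apply: filter_forall => o; apply: filter_forall => o'.
have [oS|/negP oS] := boolP (oapp (fun j => j \notin c.1) true o);
  last exact: nearW.
have [oS'|/negP oS'] := boolP (oapp (mem c.1) true o'); last first.
  by apply: nearW => z _ h; case: oS'.
have D : {for y, continuous (fun y => brick_high c.2 o' y - brick_low c.2 o y : R)}.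
  by apply: continuousB; [exact: hc|exact: lc].
have Dy : nbhs (brick_high c.2 o' y - brick_low c.2 o y) [set z : R | 0 < z].
  by apply: open_nbhs_nbhs; split; [exact: open_gt|rewrite /= subr_gt0 cy].
apply: (@filterS _ (nbhs y) _ _ _ _ (D _ Dy)) => z /=.
by rewrite subr_gt0.
Qed.

Lemma brick_cover y : exists c, brick c y.
Proof.
have tB i : (Num.truncn (x i y) < B)%N.
  by rewrite -(ltr_nat R); apply: le_lt_trans (x_lt i y); rewrite truncn_le.
pose m := [ffun i => Ordinal (tB i)].
have mE i : (m i)%:R = (Num.truncn (x i y))%:R :> R by rewrite ffunE.
(* The free coordinates are the non-integral ones, and [m] is the integral part. *)
exists ([set i | x i y != (m i)%:R]%SET, m) => -[j|] [i|] /=.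
- rewrite !inE negbK => /eqP jm im.
  rewrite jm subrr normr0 lt_min !subr_gt0 lt_neqAle eq_sym im !mE truncn_le x_ge0.
  by rewrite natr1 truncnS_gt.
- by rewrite !inE negbK => /eqP-> _; rewrite subrr normr0 divr_gt0.
- rewrite !inE => _ im; rewrite lt_min !subr_gt0 lt_neqAle eq_sym im !mE truncn_le x_ge0.
  by rewrite natr1 truncnS_gt.
- by rewrite divr_gt0.
Qed.

(* Any integer is at distance at least min(x - m, m + 1 - x) from x. *)
Lemma brick_low_ge (m m' : {ffun N -> 'I_B}) i y : (m i)%:R < x i y < (m i)%:R + 1 ->
  brick_high m (Some i) y <= brick_low m' (Some i) y.
Proof.
move=> /andP[m1 m2]; rewrite /brick_high /brick_low ge_min.
have [h|h] := leqP (m' i) (m i).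
  move: h; rewrite -(ler_nat R) => h.
  by rewrite ger0_norm; [apply/orP; left|]; lra.
move: h; rewrite -(ler_nat R) -natr1 => h.
by rewrite ler0_norm; [apply/orP; right|]; lra.
Qed.

(** If the free sets differ, let i be free only in c and j only in c'. Then c puts j closer to the
    integers than i, and c' the reverse; [brick_low_ge] makes this a contradiction. With equal free
    sets, [m] is the integral part on free coordinates and the nearest integer on the others. *)
Lemma brick_uniq c c' y : brick c y -> brick c' y -> #|c.1| = #|c'.1| -> c = c'.
Proof.
move=> cy c'y cc'.
have S : c.1 = c'.1.
  apply/eqP; rewrite eqEcard cc' leqnn andbT; apply/negP => /negP/subsetPn[i ic inc'].
  have : ~~ (c'.1 \subset c.1).
    apply/negP => sub; have : c'.1 == c.1 by rewrite eqEcard sub cc' leqnn.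
    by move=> /eqP e; rewrite e ic in inc'.
  move=> /subsetPn[j jc' jnc].
  have h1 := cy (Some j) (Some i) jnc ic.
  have h2 := c'y (Some i) (Some j) inc' jc'.
  have h3 := @brick_low_ge c.2 c'.2 i y (brick_in cy ic).
  have h4 := @brick_low_ge c'.2 c.2 j y (brick_in c'y jc').
  by have := lt_le_trans (lt_le_trans h1 h3) (ltW h2); rewrite ltNge h4.
case: c c' S cy c'y {cc'} => [S m] [S' m'] /= <- cy c'y; congr (_, _).
apply/ffunP => i; apply: val_inj => /=; apply/eqP.
have H (a b : nat) : a%:R - b%:R < 1 :> R -> (a <= b)%N.
  by rewrite ltrBlDr addrC natr1 ltr_nat ltnS.
rewrite eqn_leq; have [iS|iS] := boolP (i \in S).
  have := brick_in cy iS; have := brick_in c'y iS; move=> /= /andP[? ?] /andP[? ?].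
  by apply/andP; split; apply: H; lra.
have := brick_notin cy iS; have := brick_notin c'y iS.
rewrite /= !ltr_norml => /andP[? ?] /andP[? ?].
by apply/andP; split; apply: H; lra.
Qed.

(** The rank of a brick is its number of free coordinates: distinct for distinct bricks through a
    point by [brick_uniq], and at most k because a free coordinate is not an integer, hence not
    [z i]. *)
Lemma Dcov_le_brick (z : N -> nat) k (gamma : set (set Y)) :
  (forall y, #|[pred i | x i y != (z i)%:R]| <= k)%N ->
  (forall A : set Y,
    (forall y y' i, A y -> A y' -> `|x i y - x i y'| < 1) ->
    exists2 U, gamma U & A `<=` U) ->
  (Dcov R gamma <= k%:R%:E)%E.
Proof.
move=> xk fine.
have fb : finite_set (range brick) by exact/finite_image/finite_finset.
apply: (@le_trans _ _ (ord R (range brick))).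
  apply: ereal_inf_lbound; exists (range brick) => //; split.
    split=> //; first by move=> _ [c _ <-]; exact: brick_open.
    by apply/seteqP; split=> // y _; have [c cy] := brick_cover y; exists (brick c) => //; exists c.
  by move=> _ [c _ <-]; apply: fine => y y' i; exact: brick_diam.
have H U : exists n : nat, range brick U -> exists2 c, brick c = U & n = #|c.1|.
  have [[c _ <-]|h] := pselect (range brick U); last by exists 0%N.
  by exists #|c.1|; exists c.
have [rk rkP] := choice H; apply: (@ord_le R Y _ (fun=> rk)) => //.
  move=> y U /rkP[c <- ->] cy; apply: leq_trans (xk y).
  apply/subset_leq_card/fintype.subsetP => i /(brick_in cy) /andP[h1 h2].
  rewrite inE; apply/eqP => xz; move: h1 h2; rewrite xz natr1 !ltr_nat; lia.
move=> y U U' /rkP[c <- ->] /rkP[c' <- ->] cy c'y cc'.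
by rewrite (brick_uniq cy c'y cc').
Qed.

End BrickCover.

Lemma card_exists_le (I V : finType) (P : I -> pred V) :
  (#|[pred v | [exists k, P k v]]| <= \sum_k #|[pred v | P k v]|)%N.
Proof.
under eq_bigr do rewrite -sum1_card big_mkcond.
rewrite exchange_big -sum1_card big_mkcond /=; apply: leq_sum => v _.
rewrite inE; case: existsP => [[k Pk]|//]; rewrite (bigD1 k)//= inE Pk.
by rewrite leq_addr.
Qed.

(** * Microstates and independent sets *)

Section Microstate.
Variables (R : realType) (r : nat) (V : finType).
Variable sigma : free_group r -> {perm V}.
Notation X := (hardcore R r).

Definition err (phi : V -> X) (v : V) (g : free_group r) : R :=
  set_val (phi v) g - set_val (phi (sigma g^-1%g v)) 1%g.

(** Off the vertices with a large error the set y_v > eta is independent. For an edge from v to w =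
    sigma(s) v inside it, the hard-core relation makes the coordinate s^-1 or 1 of phi(v) vanish;
    the first contradicts y_w > eta with a small error, the second y_v > eta. *)
Lemma support_bound (phi : V -> X) (eta : R) : 0 <= eta ->
  (#|[pred v | (eta < set_val (phi v) 1%g)%R]| <= indep_number sigma +
   \sum_(k < r) #|[pred v | (eta < `|err phi v (fg_gen k)^-1%g|)%R]|)%N.
Proof.
move=> eta0.
pose S := [set v | eta < set_val (phi v) 1%g]%SET.
pose P k := [pred v | eta < `|err phi v (fg_gen k)^-1%g|].
pose D := [set v | [exists k : 'I_r, P k v]]%SET.
have iSD : independent sigma (S :\: D).
  apply/forallP => -[v k] /=; apply/negP; rewrite !inE negb_exists.
  move=> /andP[/andP[/forallP/(_ k) + yv] /andP[_ yw]].
  rewrite -leNgt /err invgK => e.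
  have [_ /(_ (fg_gen k)^-1%g k)] := set_valP (phi v); rewrite mulVg => /eqP.
  rewrite mulf_eq0 => /orP[/eqP p0|/eqP p0].
    have {}p0 : set_val (phi v) (fg_gen k)^-1%g = 0 := p0.
    move: e; rewrite p0 sub0r normrN leNgt => /negP; apply.
    exact: lt_le_trans yw (ler_norm _).
  have {}p0 : set_val (phi v) 1%g = 0 := p0.
  by move: yv; rewrite p0 ltNge eta0.
apply: (@leq_trans #|S|); first by apply: subset_leq_card; apply/fintype.subsetP => v; rewrite !inE.
rewrite -(cardsID D S) addnC leq_add//.
  exact: (@leq_bigmax_cond _ (independent sigma) (fun I => #|I|)).
apply: leq_trans (card_exists_le P).
by apply: subset_leq_card; apply/fintype.subsetP => v; rewrite !inE => /andP[].
Qed.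

(** Chebyshev's inequality: an error above eta forces a distance of at least d in the mean square
    that defines [Map]. *)
Lemma Map_err_count (rho : X -> X -> R) (eta d delta : R)
    (F : set (free_group r)) (phi : {ptws V -> X}) g :
  (forall x y, rho x y < d -> `|set_val x 1%g - set_val y 1%g| <= eta) ->
  0 < d -> 0 <= delta -> Map (@hc_act R r) rho F delta sigma phi -> F g^-1%g ->
  #|[pred v | eta < `|err phi v g|]|%:R * d ^+ 2 <= delta ^+ 2 * #|V|%:R.
Proof.
move=> rhoP d0 delta0 phiM Fg; have := phiM _ Fg; rewrite /rho_2.
set s := \sum_(v : V) _.
have s0 : 0 <= s by apply: sumr_ge0 => v _; exact: sqr_ge0.
move=> h; apply: (@le_trans _ _ s); last first.
  (* For empty [V] the mean is divided by zero and carries no information. *)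
  have [V0|V0] := posnP #|V|.
    rewrite V0 mulr0 /s big1// => v _.
    by have := card0_eq V0 v; rewrite inE.
  rewrite -ler_pdivrMr ?ltr0n// mulrC -[leLHS]sqr_sqrtr ?mulr_ge0 ?invr_ge0//.
  by rewrite ler_pXn2r ?nnegrE ?sqrtr_ge0//.
rewrite -sum1_card natr_sum mulr_suml big_mkcond /=; apply: ler_sum => v _.
case: ifPn => [|_]; last exact: sqr_ge0.
rewrite inE => ev; rewrite mul1r.
have : d <= rho (phi (sigma g^-1%g v)) (hc_act g^-1%g (phi v)).
  rewrite leNgt; apply/negP => /rhoP; apply/negP; rewrite -ltNge.
  apply: lt_le_trans ev _; rewrite /err distrC.
  change (`|set_val (phi (sigma g^-1%g v)) 1%g - set_val (phi v) g| <=
   `|set_val (phi (sigma g^-1%g v)) 1%g - set_val (phi v) ((g^-1)^-1 * 1)%g|).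
  by rewrite mulg1 invgK.
move=> dr; rewrite ler_pXn2r ?nnegrE ?(ltW d0)//; exact: le_trans (ltW d0) dr.
Qed.

End Microstate.

(** * Soft thresholding *)

Section SoftThreshold.
Variable R : realType.

(** The difference of x and its truncation to [-eta, eta]; unlike a sharp cutoff it is continuous in
    x. *)
Definition soft (eta x : R) : R := x - Num.max (- eta) (Num.min eta x).

Lemma soft_eq0 eta x : 0 <= eta -> (soft eta x == 0) = (`|x| <= eta).
Proof.
move=> e0; rewrite /soft subr_eq0 ler_norml.
apply/eqP/andP => [|[h1 h2]]; last by rewrite (min_idPr h2) (max_idPr h1).
by case: (leP (- eta) (Num.min eta x)); case: (leP eta x) => ? ? h; split; lra.
Qed.

Lemma soft_dist eta x : 0 <= eta -> `|x - soft eta x| <= eta.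
Proof.
move=> e0; rewrite /soft ler_norml.
by case: (leP (- eta) (Num.min eta x)); case: (leP eta x) => ? ?; lra.
Qed.

Lemma soft_le eta x : 0 <= eta -> `|soft eta x| <= `|x|.
Proof.
move=> e0; rewrite /soft; case: (leP (- eta) (Num.min eta x)); case: (leP eta x) => h h';
  case: (ger0P x) => x0; rewrite ler_norml; lra.
Qed.

Lemma soft_continuous eta (T : topologicalType) (f : T -> R) :
  continuous f -> continuous (fun t => soft eta (f t)).
Proof.
move=> fc t.
have ft : {for t, continuous (f : T -> R^o)} by exact: fc.
have c0 (a : R) : {for t, continuous (fun _ : T => a : R^o)}.
  exact: cst_continuous.
have c1 := continuous_max (c0 (- eta)) (continuous_min (c0 eta) ft).
exact: (continuousB ft c1).
Qed.

End SoftThreshold.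

(** * Uniform continuity and Lebesgue numbers on the subshift *)

Section MeanDimUpper.
Variables (R : realType) (r : nat).
Notation X := (hardcore R r).

(** Uniform continuity of the coordinate at the identity, from compactness applied along d tending
    to 0 from the right. *)
Lemma compatible_metric_uniform (rho : X -> X -> R) (eta : R) : compatible_metric rho ->
  0 < eta -> exists2 d, 0 < d &
    forall x y, rho x y < d -> `|set_val x 1%g - set_val y 1%g| <= eta.
Proof.
move=> hrho eta0.
have /compact_near_coveringP cK := @hc_set_compact R r.
have := cK R 0^'+ (fun d t => forall x y : X, set_val x = t -> rho x y < d ->
  `|set_val x 1%g - set_val y 1%g| <= eta) _.
case.
  move=> t tK; pose x0 : X := exist _ t (mem_set tK).
  have : \forall y \near x0, `|set_val x0 1%g - set_val y 1%g| < eta / 2.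
    have h := @hc_coord_continuous R r 1%g x0.
    by move/cvgrPdist_lt : h; apply; rewrite divr_gt0.
  move=> /(metric_nbhs hrho)[a a0 aP].
  have : nbhs x0 [set y | rho x0 y < a / 2].
    by apply/(metric_nbhs hrho); exists (a / 2) => //; rewrite divr_gt0.
  move=> [_ [ [A oA <-] At] AP].
  exists (A, [set d | d < a / 2]); first split => /=.
  - by apply: open_nbhs_nbhs; split.
  - by apply: nbhs_right_lt; rewrite divr_gt0.
  move=> [t' d] [/= At' da] x y xt' xyd.
  have x0x : rho x0 x < a / 2 by apply: AP; rewrite /= xt'.
  have x0y : rho x0 y < a.
    apply: le_lt_trans (metric_triang hrho x0 x y) _.
    by rewrite [a]splitr ltrD// (lt_trans xyd).
  have h1 : `|set_val x0 1%g - set_val x 1%g| < eta / 2.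
    by apply: aP => /=; apply: lt_trans x0x _; rewrite ltr_pdivrMr// ltr_pMr// ltr1n.
  have h2 : `|set_val x0 1%g - set_val y 1%g| < eta / 2 by exact: aP.
  apply: le_trans (ler_distD (set_val x0 1%g) _ _) _.
  by rewrite distrC [eta]splitr lerD// ltW.
move=> e /= e0 eP; exists (e / 2) => [|x y xy]; first by rewrite divr_gt0.
have := eP (e / 2); rewrite /= sub0r normrN gtr0_norm ?divr_gt0// ltr_pdivrMr//.
rewrite ltr_pMr// ltr1n => /(_ isT isT) h.
exact: (h _ (set_valP x) x y).
Qed.

Lemma hc_lebesgue_number (U : set (set X)) : finite_open_cover U ->
  exists n : nat, forall x : X, exists W, U W /\ forall y : X,
    (forall g : free_group r, (pickle g < n)%N ->
       `|set_val x g - set_val y g| < n.+1%:R^-1) -> W y.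
Proof.
move=> [_ oU cU].
(* The members of [U] are extended to subsets of the full product, where [ptws_lebesgue_number]
   applies. *)
pose gamma := [set A : set {ptws free_group r -> R} |
  exists2 W, U W & forall x : X, A (set_val x) -> W x].
have [|n nP] := @ptws_lebesgue_number R (free_group r) _ gamma (@hc_set_compact R r).
  move=> t tK; pose x0 : X := exist _ t (mem_set tK).
  have : [set: X] x0 by [].
  rewrite -cU => -[W UW Wx0].
  have : nbhs x0 W by apply: open_nbhs_nbhs; split => //; exact: oU.
  move=> [_ [ [A oA <-] At] AP].
  by exists A; [exists W|apply: open_nbhs_nbhs; split].
exists n => x; have [A [W UW AW] AP] := nP _ (set_valP x).
by exists W; split=> // y xy; apply: AW; exact: AP.
Qed.

Lemma hc_set0 : hc_set ((fun=> 0) : {ptws free_group r -> R}).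
Proof. by split=> [g|g i]; rewrite ?lexx ?ler01 ?mulr0. Qed.

Definition hc_zero : X :=
  @exist {ptws free_group r -> R} (fun x => x \in @hc_set R r) _ (mem_set hc_set0).

Lemma ptws_proj_continuous (T : choiceType) (Z : topologicalType) i :
  continuous (fun f : {ptws T -> Z} => f i).
Proof. exact: (@proj_continuous T (fun=> Z) i). Qed.

Lemma Map_coord_continuous (V : finType) (A : set {ptws V -> X}) v g :
  continuous (fun phi : A => set_val (set_val phi v) g : R).
Proof.
move=> phi.
have h1 : {for phi, continuous (fun phi : A => set_val phi : {ptws V -> X})}.
  exact: (@initial_continuous A {ptws V -> X} set_val).
have h2 := @continuous_comp A {ptws V -> X} X _ (fun f => f v) phi h1
  (@ptws_proj_continuous V X v _).
exact: (@continuous_comp A X R _ (fun x => set_val x g) phi h2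
  (@hc_coord_continuous R r g _)).
Qed.

End MeanDimUpper.

Lemma card_sum_pred (I V : finType) (P : pred (V + I * V)) :
  (#|P| = #|[pred v | P (inl v)]| + \sum_i #|[pred v | P (inr (i, v))]|)%N.
Proof.
under eq_bigr do rewrite -sum1_card.
rewrite -!sum1_card big_sumType pair_big_dep /=; congr (_ + _)%N.
by apply: eq_bigl => -[i v].
Qed.

(** * Covers of the microstate spaces *)

Section MeanDimUpperBound.
Variables (R : realType) (r : nat).
Notation X := (hardcore R r).

(** [F] and [delta] are chosen before [V] and [sigma], so that one choice serves the whole sofic
    approximation. *)
Lemma Dcov_upper (rho : X -> X -> R) (U : set (set X)) (kappa : R) :
  compatible_metric rho -> finite_open_cover U -> 0 < kappa ->
  exists (F : set (free_group r)) (delta : R),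
    [/\ finite_nonempty F, 0 < delta &
     forall (V : finType) (sigma : free_group r -> {perm V}),
       (Dcov R (@restrict_cover _ (Map (@hc_act R r) rho F delta sigma)
                                 (@prod_cover _ U V))
        <= ((indep_number sigma)%:R + kappa * #|V|%:R)%:E)%E].
Proof.
move=> hrho hU k0; have [n0 n0P] := hc_lebesgue_number hU.
(* A coordinate of phi(v) will be the sum of two values, each known up to 3 eta; 6 eta is below the
   precision 8 eta required. *)
pose eta : R := (8 * n0.+1%:R)^-1.
have eta0 : 0 < eta by rewrite invr_gt0 mulr_gt0.
have [d d0 dP] := compatible_metric_uniform hrho eta0.
(* The inverse generators serve [support_bound], the remaining elements the coordinates that the
   cover sees. *)
pose K := 1%g :: [seq (fg_gen k)^-1%g | k <- enum 'I_r] ++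
                 pmap pickle_inv (iota 0 n0).
pose m := size K; pose Kj (j : 'I_m) := tnth (in_tuple K) j.
have KjK j : Kj j \in K by exact: mem_tnth.
have KKj g : g \in K -> exists j, g = Kj j.
  by move=> gK; have /tnthP[j] : g \in in_tuple K by []; exists j.
(* There are [r] error counts from [support_bound] and [m] from the error coordinates; each may use
   c |V|. *)
pose c : R := kappa / (r + m)%:R.
have rm0 : (0 < r + m)%N by rewrite addnC.
have c0 : 0 < c by rewrite divr_gt0// ltr0n.
pose F := [set g^-1%g | g in [set` K]].
pose delta := d * Num.sqrt c.
have delta0 : 0 < delta by rewrite mulr_gt0// sqrtr_gt0.
exists F, delta; split => //.
  split; first by apply/finite_image/finite_seq.
  by exists (1^-1)%g; exists 1%g => //=; rewrite inE eqxx.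
move=> V sigma; set M := Map _ _ _ _ _.
have cnt (phi : M) g : g \in K ->
    #|[pred v | eta < `|err sigma (set_val phi) v g|]|%:R <= c * #|V|%:R.
  move=> gK.
  have Fg : F g^-1%g by exists g.
  have := Map_err_count dP d0 (ltW delta0) (set_valP phi) Fg.
  rewrite exprMn sqr_sqrtr ?(ltW c0)// -mulrA mulrC ler_pM2l ?exprn_gt0//.
pose val (i : V + 'I_m * V) (phi : M) : R :=
  match i with inl v => set_val (set_val phi v) 1%g
             | inr (j, v) => err sigma (set_val phi) v (Kj j) end.
have val1 i phi : `|val i phi| <= 1.
  case: i => [v|[j v]] /=; last first.
    have /andP[? ?] := hc_bound (set_val phi v) (Kj j).
    have /andP[? ?] := hc_bound (set_val phi (sigma (Kj j)^-1%g v)) 1%g.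
    by rewrite /err ler_norml; lra.
  by have /andP[? ?] := hc_bound (set_val phi v) 1%g; rewrite ger0_norm.
have valc i : continuous (val i : M -> R).
  case: i => [v|[j v]] /=; first exact: Map_coord_continuous.
  by move=> phi; apply: continuousB; exact: Map_coord_continuous.
(* After division by eta, unit bricks have fineness eta. The shift by [z] makes the coordinates
   non-negative and sends the thresholded value 0 to an integer. *)
pose z := (Num.truncn eta^-1).+1.
pose x i phi : R := soft eta (val i phi) / eta + z%:R.
have xz i phi : `|soft eta (val i phi) / eta| < z%:R.
  rewrite normrM normfV (gtr0_norm eta0); apply: le_lt_trans (truncnS_gt _).
  rewrite ler_pdivrMr// mulVf ?gt_eqF//; apply: le_trans (val1 i phi).
  exact/soft_le/ltW.
have iotaK (phi : M) : (#|[pred i | x i phi != z%:R]|%:R <=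
    (indep_number sigma)%:R + kappa * #|V|%:R :> R).
  have xE i : (x i phi != z%:R) = (eta < `|val i phi|).
    rewrite /x -subr_eq0 addrK mulf_eq0 invr_eq0 (gt_eqF eta0) orbF.
    by rewrite (soft_eq0 _ (ltW eta0)) -ltNge.
  have -> : kappa * #|V|%:R = \sum_(k < r) c * #|V|%:R + \sum_(j < m) c * #|V|%:R.
    rewrite !sumr_const !card_ord -mulrnDr -[RHS]mulr_natr [RHS]mulrAC divfK//.
    by rewrite pnatr_eq0 -lt0n.
  rewrite card_sum_pred natrD addrA; apply: lerD.
    apply: le_trans (_ : (indep_number sigma + \sum_(k < r) #|[pred v |
      (eta < `|err sigma (set_val phi) v (fg_gen k)^-1%g|)%R]|)%:R <= _).
      rewrite ler_nat; apply: leq_trans (support_bound sigma _ (ltW eta0)).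
      apply: subset_leq_card; apply/fintype.subsetP => v; rewrite !inE xE /= ger0_norm//.
      by have /andP[] := hc_bound (set_val phi v) 1%g.
    rewrite natrD lerD2l natr_sum; apply: ler_sum => k _; apply: cnt.
    rewrite inE mem_cat; apply/orP; right; apply/orP; left.
    by apply/mapP; exists k; rewrite ?mem_enum.
  rewrite natr_sum; apply: ler_sum => j _; apply: le_trans (cnt phi _ (KjK j)).
  rewrite ler_nat; apply: subset_leq_card; apply/fintype.subsetP => v.
  by rewrite !inE xE.
apply: (@le_trans _ _ (Num.truncn ((indep_number sigma)%:R + kappa * #|V|%:R))%:R%:E);
  last first.
  by rewrite lee_fin truncn_le addr_ge0// mulr_ge0// ltW.
apply: (@Dcov_le_brick R M _ x (z + z) _ _ _ (fun=> z)).
- move=> i phi.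
  have h1 : {for phi, continuous (fun phi : M => soft eta (val i phi) : R^o)}.
    exact: (soft_continuous (valc i)).
  have h2 (a : R) : {for phi, continuous (fun _ : M => a : R^o)}.
    exact: cst_continuous.
  exact: (continuousD (continuousM h1 (h2 _)) (h2 _)).
- by move=> i phi; have := xz i phi; rewrite /x ltr_norml => /andP[? ?]; lra.
- move=> i phi; have := xz i phi; rewrite /x ltr_norml natrD => /andP[? ?]; lra.
- by move=> phi; rewrite truncn_ge_nat; [exact: iotaK|rewrite addr_ge0// mulr_ge0// ltW].
move=> A Adiam.
have [phi0 phi0P] : exists phi0 : V -> X, forall phi v g, A phi ->
    (pickle g < n0)%N ->
    `|set_val (phi0 v) g - set_val (set_val phi v) g| < n0.+1%:R^-1.
  (* For empty [A] any centre will do. *)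
  have [[phi0 Aphi0]|noA] := pselect (A !=set0); last first.
    by exists (fun=> hc_zero R r) => phi v g Aphi; case: noA; exists phi.
  exists (set_val phi0) => phi v g Aphi gn.
  have close i : `|val i phi0 - val i phi| < 3 * eta.
    have := Adiam _ _ i Aphi0 Aphi; rewrite /x opprD addrACA subrr addr0 -mulrBl.
    rewrite normrM normfV (gtr0_norm eta0) ltr_pdivrMr// mul1r.
    have := soft_dist (val i phi0) (ltW eta0).
    have := soft_dist (val i phi) (ltW eta0).
    rewrite !ltr_norml !ler_norml => /andP[? ?] /andP[? ?] /andP[? ?].
    by apply/andP; split; lra.
  have [j gj] : exists j, g = Kj j.
    apply: KKj; rewrite inE mem_cat mem_pmap; apply/orP; right; apply/orP; right.
    by apply/mapP; exists (pickle g); rewrite ?mem_iota ?pickleK_inv.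
  have := close (inr (j, v)); have := close (inl (sigma (Kj j)^-1%g v)).
  rewrite /val /err -gj !ltr_norml => /andP[? ?] /andP[? ?].
  have -> : n0.+1%:R^-1 = 8 * eta :> R by rewrite /eta invfM mulrA divff// mul1r.
  by apply/andP; split; lra.
have [W WP] := choice (fun v => n0P (phi0 v)).
exists (set_val @^-1` [set phi : {ptws V -> X} | forall v, W v (phi v)]).
  exists [set phi : {ptws V -> X} | forall v, W v (phi v)] => //.
  by exists W => // v; have [] := WP v.
move=> phi Aphi v; have [_] := WP v; apply => g gn; exact: phi0P.
Qed.

End MeanDimUpperBound.

(** * Limits superior and the mean dimension *)

Section LimSup.
Variables (R : realType) (a : nat -> R).
Hypothesis a01 : forall n, 0 <= a n <= 1.
Let q : \bar R := limn_esup (fun n => (a n)%:E).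

Lemma limn_esup_fin : q \is a fin_num.
Proof.
have : (0 <= q)%E.
  apply: limf_esup_ge0 => [|n]; last by rewrite lee_fin; have /andP[] := a01 n.
  exact: filter_not_empty.
have : (q <= 1)%E.
  apply: (@le_trans _ _ (ereal_sup ((fun n => (a n)%:E) @` setT))).
    by apply: ereal_inf_lbound; exists setT => //; exact: filterT.
  by apply: ge_ereal_sup => _ [n _ <-]; rewrite lee_fin; have /andP[] := a01 n.
move=> q1 q0; rewrite ge0_fin_numE//; apply: le_lt_trans q1 _; exact: ltry.
Qed.

Lemma limn_esup_le_affine (u : nat -> \bar R) (A B : R) : 0 <= B ->
  (\forall n \near \oo, (u n <= (A + B * a n)%:E)%E) ->
  (limn_esup u <= (A + B * fine q)%:E)%E.
Proof.
move=> B0 uP; apply/lee_addgt0Pr => e e0.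
(* The denominator is B + 1 because B may be 0. *)
have e'0 : 0 < e / (B + 1) by rewrite divr_gt0// ltr_wpDl.
have [_ [V oV <-] Vq] := lb_ereal_inf_adherent e'0 limn_esup_fin.
apply: (@le_trans _ _ (ereal_sup (u @` (V `&` [set n | (u n <= (A + B * a n)%:E)%E])))).
  apply: ereal_inf_lbound; eexists; last reflexivity.
  exact: filterI.
apply: ge_ereal_sup => _ [n [Vn un] <-]; apply: le_trans un _.
have : ((a n)%:E < q + (e / (B + 1))%:E)%E.
  apply: le_lt_trans Vq; apply: ereal_sup_ubound; by exists n.
rewrite -[q]fineK ?limn_esup_fin// -EFinD lte_fin -EFinD lee_fin => h.
rewrite -addrA lerD2l; apply: le_trans (ler_wpM2l B0 (ltW h)) _.
rewrite mulrDr lerD2l mulrA ler_pdivrMr ?ltr_wpDl// mulrC ler_wpM2l ?(ltW e0)//.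
by rewrite lerDl.
Qed.

Lemma limn_esup_ge_affine (u : nat -> \bar R) (A B : R) : 0 <= B ->
  (\forall n \near \oo, ((A + B * a n)%:E <= u n)%E) ->
  ((A + B * fine q)%:E <= limn_esup u)%E.
Proof.
move=> B0 uP; apply: le_ereal_inf_tmp => _ [V oV <-].
apply/lee_addgt0Pr => e e0.
have e'0 : 0 < e / (B + 1) by rewrite divr_gt0// ltr_wpDl.
pose W := V `&` [set n | ((A + B * a n)%:E <= u n)%E].
have [n [Vn un] qa] : exists2 n, W n & fine q - e / (B + 1) < a n.
  apply: contrapT => no; have : (q <= (fine q - e / (B + 1))%:E)%E.
    apply: (@le_trans _ _ (ereal_sup ((fun n => (a n)%:E) @` W))).
      by apply: ereal_inf_lbound; exists W => //; exact: filterI.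
    apply: ge_ereal_sup => _ [n Wn <-]; rewrite lee_fin leNgt; apply/negP => h.
    by apply: no; exists n.
  rewrite -{1}[q]fineK ?limn_esup_fin// lee_fin; lra.
apply: (@le_trans _ _ (u n + e%:E)%E); last first.
  by apply: leeD => //; apply: ereal_sup_ubound; exists n.
apply: le_trans (leeD un (lexx _)); rewrite -EFinD lee_fin -addrA lerD2l.
have := ler_wpM2l B0 (ltW qa); rewrite mulrBr lerBlDr => h; apply: le_trans h _.
rewrite lerD2l mulrA ler_pdivrMr ?ltr_wpDl// mulrC ler_wpM2l ?(ltW e0)//.
by rewrite lerDl.
Qed.

End LimSup.

Lemma max_independent (r : nat) (V : finType) (sigma : free_group r -> {perm V}) :
  exists2 e : 'I_(indep_number sigma) -> V, injective e &
    forall i j k, sigma (fg_gen k) (e i) <> e j.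
Proof.
have [I iI ->] : exists2 I : {set V}, independent sigma I & indep_number sigma = #|I|.
  rewrite /indep_number; have [|I] := @eq_bigmax_cond _ (independent sigma) (fun I => #|I|).
    (* The empty set is independent, so the maximum is attained. *)
    by apply/card_gt0P; exists (@finset.set0 V); apply/forallP => p; rewrite inE.
  by move=> iI ->; exists I.
exists enum_val => [|i j k ij]; first exact: enum_val_inj.
have := forallP iI (enum_val i, k).
by rewrite /= ij !enum_valP.
Qed.

Section MeanDimension.
Variables (R : realType) (r : nat) (V : nat -> finType).
Variable sigma : forall n : nat, free_group r -> {perm (V n)}.
Hypothesis hsigma : hom_sofic_approx R sigma.
Notation X := (hardcore R r).

Lemma near_card_gt0 : \forall n \near \oo, (0 < #|V n|)%N.
Proof. by have := card_to_infty hsigma => /(_ _ (nbhs_infty_gt 0)). Qed.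

Definition indep_ratio n : R := (indep_number (@sigma n))%:R / #|V n|%:R.

Lemma indep_ratio01 n : 0 <= indep_ratio n <= 1.
Proof.
rewrite /indep_ratio divr_ge0//=; have [->|V0] := posnP #|V n|; first by rewrite invr0 mulr0.
rewrite ler_pdivrMr ?ltr0n// mul1r ler_nat.
by apply/bigmax_leqP => I _; exact: max_card.
Qed.

Lemma q_SigmaE : q_Sigma R sigma = (fine (q_Sigma R sigma))%:E.
Proof. by rewrite fineK// (limn_esup_fin indep_ratio01). Qed.

Lemma mdim_hardcore (rho : X -> X -> R) : compatible_metric rho ->
  mdim sigma (@hc_act R r) rho = q_Sigma R sigma.
Proof.
move=> hrho; apply/eqP; rewrite eq_le; apply/andP; split.
  (* Upper bound: each cover gets its own [F] and [delta], with kappa = [e]. *)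
  apply: ge_ereal_sup => _ [U hU <-]; apply/lee_addgt0Pr => e e0.
  have [F [delta [hF d0 DP]]] := Dcov_upper hrho hU e0.
  apply: (@le_trans _ _ (limn_esup (fun n =>
      Dcov R (@restrict_cover _ (Map (@hc_act R r) rho F delta (@sigma n))
                           (@prod_cover _ U (V n)))
      * (#|V n|%:R^-1)%:E)%E)).
    apply: (@le_trans _ _ (ereal_inf [set limn_esup (fun n =>
      Dcov R (@restrict_cover _ (Map (@hc_act R r) rho F delta (@sigma n))
                           (@prod_cover _ U (V n)))
      * (#|V n|%:R^-1)%:E)%E | delta in [set d : R | 0 < d]])).
      by apply: ereal_inf_lbound; exists F.
    by apply: ereal_inf_lbound; exists delta.
  rewrite q_SigmaE addeC -EFinD -[in leRHS](mul1r (fine _)).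
  apply: (limn_esup_le_affine indep_ratio01) => //.
  apply: filterS near_card_gt0 => n V0.
  have V0' : 0 < #|V n|%:R :> R by rewrite ltr0n.
  rewrite lee_pdivrMr// -EFinM; apply: le_trans (DP _ _) _.
  by rewrite lee_fin mul1r mulrDl /indep_ratio divfK ?gt_eqF// addrC.
(* Lower bound: the single cover [low_high], with every [F] and [delta]. *)
apply: le_ereal_sup_tmp; eexists; first by exists (@low_high R r); [exact: low_high_cover|reflexivity].
apply: le_ereal_inf_tmp => _ [F hF <-]; apply: le_ereal_inf_tmp => _ [delta d0 <-].
rewrite q_SigmaE -(add0r (fine _)) -[in leLHS](mul1r (fine _)).
apply: (limn_esup_ge_affine indep_ratio01) => //.
apply: filterS near_card_gt0 => n V0.
have V0' : 0 < #|V n|%:R :> R by rewrite ltr0n.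
rewrite add0r mul1r lee_pdivlMr// -EFinM /indep_ratio divfK ?gt_eqF//.
have [e einj eind] := max_independent (@sigma n).
have sM g h v : sigma n (g * h)%g v = sigma n g (sigma n h v) := hom_mul hsigma g h v.
apply: (Dcov_ge sM F _ d0 einj eind) => x.
by apply/(metric_eq0 hrho).
Qed.

End MeanDimension.

(** * Metric mean dimension *)

Section Cardinality.

Lemma card_eq_range (T : finType) (U : Type) (f : T -> U) :
  injective f -> (range f #= `I_#|T|)%card.
Proof.
move=> finj; apply: card_eq_trans (inj_card_eq (in2W finj)) _.
rewrite card_eq_sym.
have -> : `I_#|T| = range (fun x : T => enum_rank x : nat).
  apply/seteqP; split=> [i /= ilt|_ [x _ <-]]; last exact: ltn_ord.
  by exists (enum_val (Ordinal ilt)) => //; rewrite enum_valK.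
by apply: inj_card_eq; apply: in2W => x y /ord_inj /enum_rank_inj.
Qed.

Lemma card_eq_inj_le (T : finType) (U : Type) (E : set U) k (g : U -> T)
    (C : pred T) : (E #= `I_k)%card ->
  (forall x y, E x -> E y -> g x = g y -> x = y) ->
  (forall x, E x -> C (g x)) -> (k <= #|C|)%N.
Proof.
move=> /card_set_bijP[f [_ _ fsurj]] ginj gC.
have H (i : 'I_k) : exists x, E x /\ f x = i.
  by have [x Ex fx] := fsurj i (ltn_ord i); exists x.
have [x xP] := choice H.
have gxinj : injective (g \o x).
  move=> i j gij; have xij := ginj _ _ (xP i).1 (xP j).1 gij.
  by apply: ord_inj; rewrite -(xP i).2 -(xP j).2 xij.
rewrite -[leqLHS]card_ord -(card_imset _ gxinj); apply: subset_leq_card.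
by apply/fintype.subsetP => _ /imsetP[i _ ->]; apply: gC; have [] := xP i.
Qed.

(** There are at most 2^|V| supports, and at most (M+1)^k functions vanishing off a given one. *)
Lemma card_ffun_support (V : finType) M k :
  (#|[pred f : {ffun V -> 'I_M.+1} | #|[pred v | f v != ord0]| <= k]| <=
   2 ^ #|V| * M.+1 ^ k)%N.
Proof.
pose supp (f : {ffun V -> 'I_M.+1}) := [set v | f v != ord0]%SET.
have suppE f : #|supp f| = #|[pred v | f v != ord0]|.
  by apply: fintype.eq_card => v; rewrite !inE.
rewrite -sum1_card (partition_big supp (fun S => #|S| <= k)%N) /=; last first.
  by move=> f; rewrite inE suppE.
apply: (@leq_trans (\sum_(S : {set V} | #|S| <= k) M.+1 ^ k)%N); last first.
  rewrite sum_nat_const leq_mul2r -cardsT -card_powerset; apply/orP; right.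
  by apply: subset_leq_card; apply/fintype.subsetP => S _; rewrite powersetE finset.subsetT.
apply: leq_sum => S Sk; rewrite sum1_card.
apply: (@leq_trans #|pffun_on ord0 S [pred _ : 'I_M.+1 | true]|).
  apply: subset_leq_card; apply/fintype.subsetP => f.
  rewrite inE => /andP[_ /eqP <-]; apply/pffun_onP; split=> //.
  by apply/fintype.subsetP => v; rewrite !inE.
by rewrite card_pffun_on (fintype.eq_card (B := 'I_M.+1))// card_ord leq_pexp2l.
Qed.

End Cardinality.

(** * Separated sets of microstates *)

Section SeparatedSets.
Variables (R : realType) (r : nat) (V : finType).
Variable sigma : free_group r -> {perm V}.
Notation X := (hardcore R r).

Lemma sep_number_ge (F : set (free_group r)) (delta eps : R) :
  (forall g h v, sigma (g * h)%g v = sigma g (sigma h v)) -> 0 < delta ->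
  0 < eps ->
  (((Num.truncn (2 * eps)^-1).+1 ^ indep_number sigma)%:R%:E <=
   sep_number (Map (@hc_act R r) (@rho0 R r) F delta sigma)
     (@rho_oo R X (@rho0 R r) V) eps)%E.
Proof.
(* [m] counts the multiples of 2 eps in [0, 1]; mesh eps would not give the strict separation. *)
move=> sM d0 eps0; set m := (Num.truncn _).+1; set n := indep_number sigma.
have [e einj eind] := max_independent sigma.
pose t (f : {ffun 'I_n -> 'I_m}) : {ptws 'I_n -> R} := fun i => (f i)%:R * (2 * eps).
have t01 f i : 0 <= t f i <= 1.
  rewrite mulr_ge0 ?mulr_ge0 ?(ltW eps0)//= -ler_pdivlMr ?mulr_gt0//.
  rewrite mul1r -truncn_ge_nat ?invr_ge0 ?mulr_ge0 ?(ltW eps0)//.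
  by rewrite -ltnS ltn_ord.
pose s f : {ptws V -> X} := mstate sM eind (t f).
have sep f g : f <> g -> eps < rho_oo (@rho0 R r) (s f) (s g).
  move=> fg; have [i fgi] : exists i, f i != g i.
    apply/existsP; rewrite -negb_forall; apply/negP => /forallP h; apply: fg.
    by apply/ffunP => i; apply/eqP/h.
  apply: (@lt_le_trans _ _ (@rho0 R r (s f (e i)) (s g (e i)))); last first.
    exact: (le_bigmax 0 (fun v => @rho0 R r (s f v) (s g v)) (e i)).
  rewrite /rho0 !mstate_e// !clamp_id// /t -mulrBl normrM.
  rewrite [X in _ * X]gtr0_norm ?mulr_gt0//.
  have : 1 <= `|(f i)%:R - (g i)%:R| :> R.
    move: fgi; rewrite neq_ltn => /orP[]; rewrite -(ler_nat R) -natr1 => ?.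
      by rewrite ler0_norm; lra.
    by rewrite ger0_norm; lra.
  by move=> /(ler_wpM2r (ltW eps0)); lra.
apply: ereal_sup_ubound; exists (m ^ n)%N => //; exists (range s); split.
- by move=> _ [f _ <-]; apply: mstate_Map => // x; rewrite /rho0 subrr normr0.
- have -> : (m ^ n)%N = #|{: {ffun 'I_n -> 'I_m}}| by rewrite card_ffun !card_ord.
  apply: card_eq_range => f g sfg; apply: contrapT => /sep.
  rewrite sfg ltNge => /negP; apply; apply/bigmax_leP.
  by split=> [|v _]; rewrite ?(ltW eps0)// /rho0 subrr normr0 ltW.
- by move=> _ _ [f _ <-] [g _ <-] fg; apply: sep => fg'; apply: fg; rewrite fg'.
Qed.

(** Microstates with equal integral parts of all y_v / eps are within eps, so a separated set
    injects into these codes. A non-zero entry forces y_v >= eps > eta, which [support_bound] and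
    [Map_err_count] make rare. *)
Lemma sep_number_le (F : set (free_group r)) (delta eps eta : R) :
  0 < eps -> 0 < eta < eps -> 0 < delta ->
  (forall k, F (fg_gen k)) ->
  (sep_number (Map (@hc_act R r) (@rho0 R r) F delta sigma)
     (@rho_oo R X (@rho0 R r) V) eps <=
   (2 ^ #|V| * (Num.truncn eps^-1).+1 ^ Num.truncn ((indep_number sigma)%:R +
      r%:R * (delta / eta) ^+ 2 * #|V|%:R))%:R%:E)%E.
Proof.
move=> eps0 /andP[eta0 etaeps] d0 FP; set M := Num.truncn eps^-1.
apply: ge_ereal_sup => _ [k [E [EM Ek Esep]] <-]; rewrite lee_fin ler_nat.
pose y (phi : {ptws V -> X}) v : R := set_val (phi v) 1%g.
have y01 phi v : 0 <= y phi v <= 1 by exact: hc_bound.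
have yM phi v : (Num.truncn (y phi v / eps) < M.+1)%N.
  rewrite ltnS /M; have /andP[y0 y1] := y01 phi v.
  apply: le_truncn; rewrite ler_pdivrMr// mulVf ?gt_eqF//.
pose code phi : {ffun V -> 'I_M.+1} := [ffun v => Ordinal (yM phi v)].
apply: leq_trans (card_ffun_support V M _).
apply: (card_eq_inj_le Ek (g := code)).
  move=> phi psi Ephi Epsi cc; apply: contrapT => /(Esep _ _ Ephi Epsi).
  rewrite ltNge => /negP; apply; apply/bigmax_leP.
  split=> [|v _]; first exact: ltW.
  have : Num.truncn (y phi v / eps) = Num.truncn (y psi v / eps).
    by have := congr1 (fun f : {ffun V -> 'I_M.+1} => f v : nat) cc; rewrite /= !ffunE.
  have /andP[a0 _] := y01 phi v; have /andP[b0 _] := y01 psi v.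
  have /truncn_itv : 0 <= y phi v / eps by rewrite divr_ge0// ltW.
  have /truncn_itv : 0 <= y psi v / eps by rewrite divr_ge0// ltW.
  move=> /[swap] + + e; rewrite e => /andP[h1 h2] /andP[h3 h4].
  have : `|y phi v / eps - y psi v / eps| <= 1.
    by rewrite ler_norml -natr1 in h2 h4 *; apply/andP; split; lra.
  by rewrite -mulrBl normrM normfV (gtr0_norm eps0) ler_pdivrMr// mul1r.
move=> phi /EM phiM; rewrite /= truncn_ge_nat; last first.
  by rewrite addr_ge0// mulr_ge0// mulr_ge0// sqr_ge0.
apply: (@le_trans _ _ #|[pred v | eta < y phi v]|%:R).
  rewrite ler_nat; apply: subset_leq_card; apply/fintype.subsetP => v.
  rewrite !inE ffunE -val_eqE /= -lt0n truncn_ge_nat; last first.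
    by have /andP[a0 _] := y01 phi v; rewrite divr_ge0// ltW.
  by rewrite ler_pdivlMr// mul1r; exact: lt_le_trans.
apply: (@le_trans _ _ (indep_number sigma + \sum_(k < r) #|[pred v |
      (eta < `|err sigma phi v (fg_gen k)^-1%g|)%R]|)%:R).
  by rewrite ler_nat; exact: (support_bound sigma phi (ltW eta0)).
rewrite natrD lerD2l natr_sum.
have -> : r%:R * (delta / eta) ^+ 2 * #|V|%:R =
  \sum_(k < r) ((delta / eta) ^+ 2 * #|V|%:R) :> R.
  by rewrite sumr_const card_ord -[RHS]mulr_natl mulrA.
apply: ler_sum => i _.
(* For [rho0] the modulus of continuity is eta itself. *)
have rP (x z : X) : @rho0 R r x z < eta -> `|set_val x 1%g - set_val z 1%g| <= eta.
  exact: ltW.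
have Fi : F (fg_gen i)^-1^-1%g by rewrite invgK; exact: FP.
have := Map_err_count rP eta0 (ltW d0) phiM Fi.
by rewrite -ler_pdivlMr ?exprn_gt0// mulrAC -expr_div_n.
Qed.

End SeparatedSets.

Lemma limf_esup_einf_eq (R : realType) (F : set_system R)
    (FF : ProperFilter F) (f : R -> \bar R) (q : R) :
  (forall e : R, 0 < e ->
     \forall x \near F, ((q - e)%:E <= f x <= (q + e)%:E)%E) ->
  limf_esup f F = q%:E /\ limf_einf f F = q%:E.
Proof.
have esupE (g : R -> \bar R) (p : R) : (forall e : R, 0 < e ->
     \forall x \near F, ((p - e)%:E <= g x <= (p + e)%:E)%E) ->
  limf_esup g F = p%:E.
  move=> gp; apply/eqP; rewrite eq_le; apply/andP; split.
    apply/lee_addgt0Pr => e e0.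
    apply: (@le_trans _ _ (ereal_sup (g @` [set x | ((p - e)%:E <= g x <= (p + e)%:E)%E]))).
      by apply: ereal_inf_lbound; eexists; [exact: gp e0|].
    by apply: ge_ereal_sup => _ [x /andP[_ gx] <-].
  apply: le_ereal_inf_tmp => _ [A FA <-]; apply/lee_addgt0Pr => e e0.
  have [x [Ax /andP[gx _]]] := filter_ex (filterI FA (gp e e0)).
  apply: (@le_trans _ _ (g x + e%:E)%E).
    by rewrite -leeBlDr.
  by apply: leeD => //; apply: ereal_sup_ubound; exists x.
move=> fq; split; first exact: esupE.
(* The lower limit is an upper limit of -f, and the hypothesis is symmetric under negation. *)
rewrite /limf_einf (esupE _ (- q)) ?EFinN ?oppeK// => e e0.
apply: filterS (fq e e0) => x /andP[h1 h2].
by rewrite leeNr leeNl -!EFinN !opprD !opprK h1 h2.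
Qed.

(** * Growth of the separation numbers *)

Section MetricMeanDimension.
Variables (R : realType) (r : nat) (hr : (0 < r)%N) (V : nat -> finType).
Variable sigma : forall n : nat, free_group r -> {perm (V n)}.
Hypothesis hsigma : hom_sofic_approx R sigma.
Notation X := (hardcore R r).
Notation q := (fine (q_Sigma R sigma)).
Notation h eps := (h_eps sigma (@hc_act R r) (@rho0 R r) eps).

Lemma q_ge0 : 0 <= q.
Proof.
rewrite fine_ge0//; apply: limf_esup_ge0 => [|n].
  exact: filter_not_empty.
by rewrite lee_fin; have /andP[] := indep_ratio01 R sigma n.
Qed.

(** The grid has more than 1/(2 eps) values per coordinate; eps < 1/2 gives -ln(2 eps) the sign
    needed for the limit superior. *)
Lemma h_eps_ge (eps : R) : 0 < eps < 1/2 -> ((q * - ln (2 * eps))%:E <= h eps)%E.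
Proof.
move=> /andP[eps0 eps1]; have e20 : 0 < 2 * eps by rewrite mulr_gt0.
apply: le_ereal_inf_tmp => _ [F hF <-]; apply: le_ereal_inf_tmp => _ [delta d0 <-].
rewrite -(add0r (q * _)) mulrC.
apply: (limn_esup_ge_affine (indep_ratio01 R sigma)).
  by rewrite oppr_ge0 -ln1 ler_ln ?posrE//; lra.
apply: filterS (near_card_gt0 hsigma) => n V0.
have V0' : 0 < #|V n|%:R :> R by rewrite ltr0n.
rewrite muleC lee_pdivlMr// -EFinM add0r -mulrA /indep_ratio divfK ?gt_eqF//.
have sM g h v : sigma n (g * h)%g v = sigma n g (sigma n h v) := hom_mul hsigma g h v.
have := sep_number_ge F sM d0 eps0; set m := (Num.truncn _).+1; set N := sep_number _ _ _ => mN.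
have m0 : 0 < (m ^ indep_number (@sigma n))%:R :> R by rewrite ltr0n expn_gt0.
apply: (@le_trans _ _ (lne (m ^ indep_number (@sigma n))%:R%:E)); last first.
  rewrite lee_lne// in_itv/= leey andbT ?lee_fin ?(ltW m0)//.
  by apply: le_trans mN; rewrite lee_fin ltW.
rewrite lne_EFin// lee_fin natrX lnXn ?ltr0n// -[leRHS]mulr_natr ler_wpM2r//.
rewrite -lnV ?posrE// ler_ln ?posrE ?invr_gt0 ?ltr0n//.
exact/ltW/truncnS_gt.
Qed.

(** The first ln 2 comes from the 2^|V| supports. An entry of a code takes at most floor(1/eps) + 1
    <= 2/eps values, whence ln 2 - ln eps. *)
Lemma h_eps_le (eps : R) : 0 < eps < 1 ->
  (h eps <= (ln 2 + q * (ln 2 - ln eps))%:E)%E.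
Proof.
move=> /andP[eps0 eps1]; apply/lee_addgt0Pr => e e0.
pose B : R := ln 2 - ln eps.
have B0 : 0 < B.
  by rewrite subr_gt0 ltr_ln ?posrE//; apply: lt_trans eps1 _; rewrite ltr1n.
(* The kappa |V| additional non-zero entries then cost kappa B = e per vertex. *)
pose kappa := e / B; have k0 : 0 < kappa by rewrite divr_gt0.
pose eta := eps / 2; have eta0 : 0 < eta by rewrite divr_gt0.
have etaP : 0 < eta < eps by rewrite eta0 ltr_pdivrMr// ltr_pMr// ltr1n.
have r0 : 0 < r%:R :> R by rewrite ltr0n.
pose delta := eta * Num.sqrt (kappa / r%:R).
have d0 : 0 < delta by rewrite mulr_gt0// sqrtr_gt0 divr_gt0.
have dk : r%:R * (delta / eta) ^+ 2 = kappa.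
  rewrite /delta mulrAC divff ?gt_eqF// mul1r sqr_sqrtr ?divr_ge0 ?ltW//.
  by rewrite mulrC divfK// gt_eqF.
pose F := range (@fg_gen r).
have hF : finite_nonempty F.
  split; first exact/finite_image/finite_finset.
  by exists (fg_gen (Ordinal hr)); exists (Ordinal hr).
have FP k : F (fg_gen k) by exists k.
apply: (@le_trans _ _ (limn_esup (fun n => (#|V n|%:R^-1)%:E *
    lne (sep_number (Map (@hc_act R r) (@rho0 R r) F delta (@sigma n))
                    (@rho_oo R X (@rho0 R r) (V n)) eps))%E)).
  apply: (@le_trans _ _ (ereal_inf [set limn_esup (fun n => (#|V n|%:R^-1)%:E *
    lne (sep_number (Map (@hc_act R r) (@rho0 R r) F delta (@sigma n))
       (@rho_oo R X (@rho0 R r) (V n)) eps))%E | delta in [set d : R | 0 < d]])).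
    by apply: ereal_inf_lbound; exists F.
  by apply: ereal_inf_lbound; exists delta.
have -> : ((ln 2 + q * (ln 2 - ln eps))%:E + e%:E = (ln 2 + kappa * B + B * q)%:E)%E.
  by rewrite -EFinD /kappa divfK ?gt_eqF// mulrC addrAC.
apply: (limn_esup_le_affine (indep_ratio01 R sigma)); first exact: ltW.
apply: filterS (near_card_gt0 hsigma) => n V0.
have V0' : 0 < #|V n|%:R :> R by rewrite ltr0n.
rewrite muleC lee_pdivrMr// -EFinM.
have := sep_number_le (@sigma n) eps0 etaP d0 FP; rewrite dk.
set k := Num.truncn (_ + _); set M := (Num.truncn _).+1; set N := sep_number _ _ _ => Nb.
have M0 : 0 < M%:R :> R by rewrite ltr0n.
have [N0|N0] := leP N 0%E.
  by rewrite le0_lneNy// leNye.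
apply: (@le_trans _ _ (lne (2 ^ #|V n| * M ^ k)%:R%:E)).
  by rewrite lee_lne ?Nb// in_itv/= leey andbT; [exact: ltW|rewrite lee_fin].
rewrite lne_EFin ?ltr0n ?muln_gt0 ?expn_gt0// lee_fin natrM !natrX.
rewrite lnM ?posrE ?exprn_gt0// !lnXn//.
rewrite -[ln 2 *+ _]mulr_natr -[ln M%:R *+ _]mulr_natl.
have MB : ln M%:R <= B.
  rewrite /B -ln_div ?posrE// ler_ln ?posrE ?divr_gt0//.
  rewrite /M -natr1 ler_pdivlMr// mulrDl mul1r.
  have : (Num.truncn eps^-1)%:R * eps <= 1.
    by rewrite -ler_pdivlMr// mul1r truncn_le invr_ge0 ltW.
  lra.
have kB : k%:R <= (indep_number (@sigma n))%:R + kappa * #|V n|%:R :> R.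
  by rewrite truncn_le addr_ge0// mulr_ge0// ltW.
rewrite mulrDl mulrDl -addrA lerD2l.
have -> : kappa * B * #|V n|%:R + B * indep_ratio R sigma n * #|V n|%:R =
  ((indep_number (@sigma n))%:R + kappa * #|V n|%:R) * B.
  have aV : indep_ratio R sigma n * #|V n|%:R = (indep_number (@sigma n))%:R.
    by rewrite /indep_ratio divfK ?gt_eqF.
  by rewrite -(mulrA B) aV; ring.
by apply: ler_pM => //; rewrite ln_ge0// ler1n.
Qed.

Lemma mmdim_hardcore :
  upper_mmdim sigma (@hc_act R r) (@rho0 R r) = q_Sigma R sigma /\
  lower_mmdim sigma (@hc_act R r) (@rho0 R r) = q_Sigma R sigma.
Proof.
rewrite (q_SigmaE R sigma); apply: limf_esup_einf_eq => e e0.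
have q0 := q_ge0; have l2 : 0 < ln 2 :> R by rewrite ln_gt0// ltr1n.
(* With L = |ln eps| both bounds for h / L are within ln 2 (1 + q) / L of q, so L > C suffices. *)
pose C : R := ln 2 * (1 + q) / e.
have epsC : \forall eps \near 0^'+, eps < expR (- C) :> R.
  exact/nbhs_right_lt/expR_gt0.
have eps12 : \forall eps \near 0^'+, eps < 1/2 :> R.
  by apply: nbhs_right_lt; rewrite divr_gt0.
have eps0 : \forall eps \near 0^'+, 0 < eps :> R by exact: nbhs_right_gt.
apply: filterS3 epsC eps12 eps0 => eps epsC eps12 eps0.
pose L : R := - ln eps.
have CL : C < L.
  by rewrite /L ltrNr -(expRK (- C)) ltr_ln ?posrE ?expR_gt0.
have L0 : 0 < L.
  apply: le_lt_trans CL; apply: divr_ge0; last exact: ltW.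
  by apply: mulr_ge0; [exact: ltW|exact: addr_ge0].
have -> : `|ln eps| = L by rewrite /L ltr0_norm// -oppr_gt0.
have eL : ln 2 * (1 + q) < L * e by rewrite -ltr_pdivrMr.
apply/andP; split.
  rewrite lee_pdivlMr// -EFinM; apply: le_trans (h_eps_ge _); last by rewrite eps0.
  rewrite lee_fin lnM ?posrE// opprD -/L.
  nra.
rewrite lee_pdivrMr// -EFinM; apply: le_trans (h_eps_le _) _.
  by rewrite eps0; lra.
rewrite lee_fin -/L.
nra.
Qed.

End MetricMeanDimension.

Theorem theorem1p1 (R : realType) (r : nat) (hr : (0 < r)%N)
    (V : nat -> finType) (sigma : forall n : nat, free_group r -> {perm (V n)})
    (hsigma : hom_sofic_approx R sigma) :
  (forall rho : hardcore R r -> hardcore R r -> R,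
     compatible_metric rho ->
     mdim sigma (@hc_act R r) rho = q_Sigma R sigma) /\
  lower_mmdim sigma (@hc_act R r) (@rho0 R r) = q_Sigma R sigma /\
  upper_mmdim sigma (@hc_act R r) (@rho0 R r) = q_Sigma R sigma.
Proof.
have [upperE lowerE] := mmdim_hardcore hr hsigma.
by split=> // rho; exact: mdim_hardcore.
Qed.
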